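(* Let $X=\nu_2(\mathbb{P}^2)\subseteq\mathbb{P}^5$ be the Veronese surface. Then: (1) For every $k\ge 3$, there is no spurious second-order stationary point in the interior for the rank-$k$ problem: no $\mathbf{l}\in R_1^k$ with $\sigma_k(\mathbf{l})\in\operatorname{int}\Sigma_X$ is a spurious second-order stationary point for any target $\bar f\in R_2$. (2) For $k=3$, there is no spurious local minimum of the rank-$3$ problem, for any target $\bar f\in R_2$. In particular, any spurious second-order stationary point $\mathbf{l}\in R_1^3$ (for some target $\bar f$) such that $\sigma_3(\mathbf{l})$ has infinitely many Gram matrices of rank at most $3$ must lie on the boundary, i.e. $\sigma_3(\mathbf{l})\in\partial\Sigma_X$, and $\sigma_3(\mathbf{l})$ corresponds, up to a projective (linear) change of coordinates on $\mathbb{P}^2$, to a binary quartic form, i.e. a quartic form involving only two of the three variables.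
   Context: $\nu_2:\mathbb{P}^2\to\mathbb{P}^5$ is the degree-$2$ Veronese embedding. Let $S=\mathbb{R}[z_0,\dots,z_5]$ be the real homogeneous coordinate ring of $\mathbb{P}^5$, $I_X\subset S$ the saturated homogeneous ideal of $X$, $R=S/I_X$, with degree-$d$ part $R_d$. Via pullback by $\nu_2$, $R_1\cong\mathbb{R}[x_0,x_1,x_2]_2$ and $R_2\cong\mathbb{R}[x_0,x_1,x_2]_4$. $\Sigma_X\subseteq R_2$ is the convex cone of finite sums of squares of elements of $R_1$. Fix an inner product on $R_2$ with norm $\|\cdot\|$. For $\mathbf{l}=(l_1,\dots,l_k)\in R_1^k$ put $\sigma_k(\mathbf{l})=\sum_{i=1}^k l_i^2$. For a target $\bar f\in R_2$ the rank-$k$ problem is $\min_{\mathbf{l}\in R_1^k}\|\sigma_k(\mathbf{l})-\bar f\|^2$. A tuple $\mathbf{l}$ is a spurious second-order stationary point for $\bar f$ if the gradient of $\|\sigma_k(\cdot)-\bar f\|^2$ at $\mathbf{l}$ is zero and its Hessian there is positive semidefinite, but $\mathbf{l}$ is not a global minimizer; it is a spurious local minimum if it is a local but not a global minimizer. A Gram matrix of $f\in R_2$ is a positive semidefinite quadratic form $F\in S_2$ (equivalently a positive semidefinite symmetric matrix) whose image under the quotient map $S_2\to R_2$ is $f$. *)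

(* Defs.v *)
From HB Require Import structures.
From mathcomp Require Import all_boot all_order all_algebra sesquilinear.
From mathcomp Require Import all_classical all_reals all_analysis.
(* The notations of mpoly clash with those of mathcomp-analysis. *)
From mathcomp.multinomials Require Import -(notations) mpoly.

Set Implicit Arguments.
Unset Strict Implicit.
Unset Printing Implicit Defensive.

Import Order.TTheory GRing.Theory Num.Theory numFieldNormedType.Exports.

Local Open Scope classical_set_scope.
Local Open Scope ring_scope.

(* A finite-dimensional real vector space, normed by the sup norm of the
   coordinates in the basis picked by vbasis. Only the topology and the
   derivatives are used, and in finite dimension all norms induce the same. *)
Definition normedvect (R : realType) (V : vectType R) : Type := V.

Section NormedVect.
Variables (R : realType) (V : vectType R).

HB.instance Definition _ := GRing.Lmodule.on (normedvect V).

Let coords (v : V) : 'rV[R]_(\dim {:V}) :=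
  \row_i coord (vbasis {:V}) i v.

Let vnorm (v : normedvect V) : R := `|coords v|.

Let vnormD (u v : normedvect V) : vnorm (u + v) <= vnorm u + vnorm v.
Proof.
rewrite /vnorm (_ : coords (u + v) = coords u + coords v) ?ler_normD//.
by apply/rowP => i; rewrite !mxE; exact: linearD.
Qed.

Let vnormZ (a : R) (v : normedvect V) : vnorm (a *: v) = `|a| * vnorm v.
Proof.
rewrite /vnorm (_ : coords (a *: v) = a *: coords v) ?normrZ//.
by apply/rowP => i; rewrite !mxE; exact: linearZ.
Qed.

Let vnorm0_eq0 (v : normedvect V) : vnorm v = 0 -> v = 0.
Proof.
move=> /normr0_eq0 /rowP v0; rewrite [LHS](coord_vbasis (memvf (v : V))).
by apply: big1 => i _; have := v0 i; rewrite !mxE => ->; exact: scale0r.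
Qed.

HB.instance Definition _ :=
  Lmodule_isNormed.Build R (normedvect V) vnormD vnormZ vnorm0_eq0.

End NormedVect.

(* The coordinate ring of the Veronese surface, graded by half the degree of the
   ternary forms obtained by pullback along the Veronese embedding. *)
Definition R1 (R : realType) := dhomog 3 R 2.
Definition R2 (R : realType) := normedvect (dhomog 3 R 4).
Definition R1tuple (R : realType) (k : nat) := normedvect {ffun 'I_k -> R1 R}.

Definition sqr (R : realType) (l : R1 R) : R2 R :=
  DHomog (dhomogM (dhomog_is_dhomog l) (dhomog_is_dhomog l)).

Definition sigma (R : realType) (k : nat) (l : R1tuple R k) : R2 R :=
  \sum_(i < k) sqr ((l : {ffun 'I_k -> R1 R}) i).

Definition SOScone (R : realType) : set (R2 R) :=
  [set f | exists (k : nat) (l : R1tuple R k), f = sigma l].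
Arguments SOScone : clear implicits.

Definition boundary (T : topologicalType) (A : set T) : set T :=
  closure A `\` A°.

Definition loss (R : realType) (ip : {dot R2 R for idfun}) (k : nat)
    (fbar : R2 R) (l : R1tuple R k) : R :=
  ip (sigma l - fbar) (sigma l - fbar).

Section Optimization.
Variables (R : realType) (V : normedModType R).
Implicit Types (phi : V -> R) (x : V).

Definition zero_gradient phi x : Prop := forall v, 'D_v phi x = 0.

Definition hessian phi x (u v : V) : R := 'D_u ('D_v phi) x.

Definition psd_hessian phi x : Prop := forall v, 0 <= hessian phi x v v.

Definition global_min phi x : Prop := forall y, phi x <= phi y.

Definition local_min phi x : Prop := \forall y \near x, phi x <= phi y.

Definition spurious_second_order_stationary phi x : Prop :=
  [/\ zero_gradient phi x, psd_hessian phi x & ~ global_min phi x].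

Definition spurious_local_min phi x : Prop :=
  local_min phi x /\ ~ global_min phi x.

End Optimization.

Definition var (R : realType) (n : nat) (i : 'I_n) : mpoly n R :=
  mpolyX R (mnm1 i).

Definition veronese (R : realType) : 6.-tuple (mpoly 3 R) :=
  let x := @var R 3 0 in let y := @var R 3 1 in let z := @var R 3 2 in
  [tuple x * x; x * y; x * z; y * y; y * z; z * z].

Definition quadric (R : realType) (F : 'M[R]_6) : mpoly 6 R :=
  \sum_(i < 6) \sum_(j < 6) F i j *: (var R i * var R j).

Definition psd_mx (R : realType) (n : nat) (F : 'M[R]_n) : Prop :=
  F^T = F /\ forall v : 'rV[R]_n, 0 <= (v *m F *m v^T) 0 0.

(* The quotient map from S_2 to R_2 is substitution of the Veronese monomials. *)
Definition gram (R : realType) (f : R2 R) (F : 'M[R]_6) : Prop :=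
  psd_mx F /\
  comp_mpoly (veronese R) (quadric F) = mpoly_of_dhomog (f : dhomog 3 R 4).

Definition linear_change (R : realType) (n : nat) (A : 'M[R]_n)
    (p : mpoly n R) : mpoly n R :=
  comp_mpoly [tuple \sum_(j < n) A i j *: var R j | i < n] p.

Definition projectively_binary (R : realType) (f : R2 R) : Prop :=
  exists (A : 'M[R]_3) (g : dhomog 2 R 4), A \in unitmx /\
    linear_change A (mpoly_of_dhomog (f : dhomog 3 R 4)) =
    mwiden (mpoly_of_dhomog g).

(* Main.v *)
From HB Require Import structures.
Require Import Defs.
From mathcomp Require Import all_boot all_order all_algebra sesquilinear.
From mathcomp Require Import all_classical all_reals all_analysis.
From mathcomp.multinomials Require Import -(notations) mpoly.
From mathcomp Require Import polyrcf ring lra.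

(** Put g = sigma(l) - fbar and L(h) = <g, h>, a linear functional on ternary quartics.
    The gradient of the loss vanishes at l exactly when every l_i lies in the kernel of the
    bilinear form (q, q') |-> L(qq') on quadrics, and the Hessian is positive semidefinite
    exactly when 2 |sum l_i v_i|^2 + L(sum v_i^2) >= 0 for all v ([stationary_critical]).
    If L >= 0 on squares, l is a global minimizer: L(sigma(l)) = 0 and the loss is convex
    in sigma ([psd_global_min]). So everything is about how L can fail to be >= 0 on squares.

    If l_0, l_1, l_2 satisfy a linear relation with coefficients c_i, the direction
    v_i = c_i q gives L(q^2) >= 0 for all q. Otherwise they span a net U of quadrics, and a
    syzygy sum l_j y_j = 0 gives L(sum y_j^2) >= 0; when this vanishes, y is a null vector
    of a positive semidefinite form, hence in its kernel, and the y_j are in the kernel of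
    L(qq') too ([critical_dichotomy]). Both facts survive a change of basis of U, with the
    sum of squares replaced by another positive definite form ([two_entry_syzygy]).

    The heart of the proof is [second_order_net_dichotomy]: such a net forces L >= 0 on
    squares, unless U = <x^2, xy, y^2> and L(xz^3) = L(yz^3) = 0 > L(z^4) in suitable linear
    coordinates. One argues on the number of variables that L really involves, i.e. on the
    linear forms z such that L kills the ideal of z.
    - If there is none, L maps cubics onto the dual of linear forms, so the cubics
      sum l_i m_i lie in a space of dimension 10 - 3 = 7; as there are 9 coefficients, U has
      two independent linear syzygies. A real cubic has a root, so some combination of their
      coefficient matrices is singular, and this degenerate syzygy exhibits U as
      <zx, zy, w>, a net with a common factor in a pencil ([three_variable_net]).
    - If L kills the ideal of z, it is a functional on binary quartics. Either the kernel of
      its Hankel matrix is at most a line, and modulo z all of U consists of multiples of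
      one quadric, which again gives a pencil with a common factor; or L kills the ideal of
      a second linear form, and is a multiple of the evaluation at a point
      ([two_variable_net]).
    - If L is a negative multiple of an evaluation, U vanishes at the point. When the
      linear parts of U there span two dimensions, the maximal minors of a 3 x 2 matrix
      give a syzygy contradicting the sign ([one_point_normal_form]); when they do not, one
      finds a pencil with a common factor once more ([one_point_net]).

    For U = <zx, zy, w> the syzygies z x (y n) = z y (x n) control the moments of L, and the
    condition that U lies in the kernel of L(qq') gives linear relations between them. If z
    is independent of x and y, one may take w = h(x, y) + c z^2 with h a multiple of xy, x^2
    or x^2 + y^2 ([transversal_psd_net]); otherwise one may take z = x, and only w = y^2
    escapes ([tangent_net]).

    In the exceptional case the kernel of L(qq') consists of quadrics vanishing at the vertex
    x = y = 0, so sigma(l) vanishes there, and sigma(l) - t z^4 is not a sum of squares for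
    any t > 0: sigma(l) is not interior ([singular_not_interior]).
    Moreover, for k = 3, sigma(l) is a form in x and y ([singular_projectively_binary]), and l
    is not a local minimum: the second-order condition is degenerate in the direction z m
    for m a linear syzygy, and a parabola in this direction changes sigma(l) only by a term
    of order t^3 orthogonal to g and a positive multiple of t^4 z^4, so that L(z^4) < 0 makes
    the loss decrease ([singular_not_local_min]). *)

Set Implicit Arguments.
Unset Strict Implicit.
Unset Printing Implicit Defensive.

Import Order.TTheory GRing.Theory Num.Theory numFieldNormedType.Exports.

Local Open Scope classical_set_scope.
Local Open Scope ring_scope.

Local Notation "c %:K" := (mpolyC 3 c) (at level 2, format "c %:K") : ring_scope.
Local Notation "d .-form" := (@ishomog1 3 _ d mdeg) (at level 1, format "d .-form").
Local Notation X i := (mpolyX _ (mnm1 (i : 'I_3))).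

(** * Frames of linear forms *)

Section Frames.
Variable R : rcfType.
Local Notation S := (mpoly 3 R).
Implicit Types (p q x y z w : S) (a b c : R).

Lemma formZ d c p : p \is d.-form -> c%:K * p \is d.-form.
Proof. by rewrite mul_mpolyC; apply: rpredZ. Qed.

Lemma formM1 p q : p \is 1.-form -> q \is 1.-form -> p * q \is 2.-form.
Proof. exact: dhomogM. Qed.

Lemma formX i : X i \is (1.-form : qualifier 0 S).
Proof. by rewrite dhomogX /= mdeg1. Qed.

Lemma form0E p : p \is 0.-form -> exists c, p = c%:K.
Proof.
move=> /dhomogP p0; exists (mcoeff (@mnm0 3) p).
rewrite {1}[p]mpolyE [in RHS](mpolyE p) raddf_sum /= rmorph_sum /=.
apply: eq_big_seq => m /p0 /= /eqP; rewrite mdeg_eq0 => /eqP->.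
by rewrite mcoeffZ mcoeffX eqxx mulr1 mpolyX0 -mul_mpolyC mulr1.
Qed.

Lemma formS_X d p : p \is d.+1.-form -> exists p0 p1 p2,
  [/\ p0 \is d.-form, p1 \is d.-form, p2 \is d.-form &
      p = X 0 * p0 + X 1 * p1 + X 2 * p2].
Proof.
move=> /dhomogP hp; rewrite [p]mpolyE big_seq_cond.
pose P q := exists p0 p1 p2,
  [/\ p0 \is d.-form, p1 \is d.-form, p2 \is d.-form &
      q = X 0 * p0 + X 1 * p1 + X 2 * p2].
apply: (big_ind P) => [|q r|m /andP[/hp /= mE _]].
- by exists 0, 0, 0; split; rewrite ?rpred0// !mulr0 !addr0.
- move=> [q0 [q1 [q2 [h0 h1 h2 ->]]]] [r0 [r1 [r2 [k0 k1 k2 ->]]]].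
  exists (q0 + r0), (q1 + r1), (q2 + r2); split; rewrite ?rpredD//; ring.
- have [i mi] : exists i, (0 < m i)%N.
    apply/existsP; apply: contra_eqT mE => /existsPn m0.
    rewrite mdegE big1// => i _; apply/eqP; rewrite -leqn0 leqNgt; exact: m0.
  set r := mcoeff m p *: mpolyX R (mnm_sub m (mnm1 i)).
  have hr : r \is d.-form.
    apply: rpredZ; rewrite dhomogX /=.
    have := mE; rewrite -{1}(@submK 3 (mnm1 i) m); last first.
      by apply/mnm_lepP => j; rewrite mnm1E; case: eqP => // <-.
    by rewrite mdegD mdeg1 addn1 => -[->].
  have -> : mcoeff m p *: mpolyX R m = X i * r.
    rewrite /r -scalerAr -mpolyXD [mnm_add _ _](_ : _ = m)//.
    by rewrite addmC submK//; apply/mnm_lepP => j; rewrite mnm1E; case: eqP => // <-.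
  case: i {mi} @r hr => -[|[|[|//]]] hi r hr.
  + exists r, 0, 0; split; rewrite ?rpred0// !mulr0 !addr0.
    by congr (mpolyX _ (mnm1 _) * _); apply: val_inj.
  + exists 0, r, 0; split; rewrite ?rpred0// !mulr0 add0r addr0.
    by congr (mpolyX _ (mnm1 _) * _); apply: val_inj.
  + exists 0, 0, r; split; rewrite ?rpred0// !mulr0 !add0r.
    by congr (mpolyX _ (mnm1 _) * _); apply: val_inj.
Qed.

Definition lincomb3 x y z w := exists c0 c1 c2, w = c0%:K * x + c1%:K * y + c2%:K * z.

(** Three linear forms that generate all of them, hence a system of linear coordinates on
    the projective plane. They are then independent, by [frame_matrix]. *)
Definition frame x y z :=
  [/\ x \is 1.-form, y \is 1.-form, z \is 1.-form &
      forall w, w \is 1.-form -> lincomb3 x y z w].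

Lemma frameX : frame (X 0) (X 1) (X 2).
Proof.
split; rewrite ?formX// => a /formS_X[p0 [p1 [p2]]].
move=> [/form0E[c0 ->] /form0E[c1 ->] /form0E[c2 ->] ->].
by exists c0, c1, c2; ring.
Qed.

Lemma frame_sub x y z x' y' z' : frame x y z ->
  x' \is 1.-form -> y' \is 1.-form -> z' \is 1.-form ->
  lincomb3 x' y' z' x -> lincomb3 x' y' z' y -> lincomb3 x' y' z' z ->
  frame x' y' z'.
Proof.
move=> [_ _ _ h] hx hy hz [a0 [a1 [a2 xE]]] [b0 [b1 [b2 yE]]] [c0 [c1 [c2 zE]]].
split=> // a /h[e0 [e1 [e2 ->]]]; rewrite xE yE zE.
exists (e0 * a0 + e1 * b0 + e2 * c0), (e0 * a1 + e1 * b1 + e2 * c1),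
  (e0 * a2 + e1 * b2 + e2 * c2).
by ring.
Qed.

Lemma frameS x y z d p : frame x y z -> p \is d.+1.-form -> exists p0 p1 p2,
  [/\ p0 \is d.-form, p1 \is d.-form, p2 \is d.-form &
      p = x * p0 + y * p1 + z * p2].
Proof.
move=> [_ _ _ h] /formS_X[p0 [p1 [p2 [h0 h1 h2 ->]]]].
have [a0 [a1 [a2 ->]]] := h _ (formX 0).
have [b0 [b1 [b2 ->]]] := h _ (formX 1).
have [c0 [c1 [c2 ->]]] := h _ (formX 2).
exists (a0%:K * p0 + b0%:K * p1 + c0%:K * p2),
  (a1%:K * p0 + b1%:K * p1 + c1%:K * p2), (a2%:K * p0 + b2%:K * p1 + c2%:K * p2).
by split; rewrite ?rpredD ?formZ//; ring.
Qed.

Definition quadric_in x y z (a b c d e f : R) : S :=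
  a%:K * (x * x) + b%:K * (x * y) + c%:K * (x * z) + d%:K * (y * y) + e%:K * (y * z)
  + f%:K * (z * z).

Lemma form_quadric_in x y z a b c (d e f : R) :
  x \is 1.-form -> y \is 1.-form -> z \is 1.-form ->
  quadric_in x y z a b c d e f \is 2.-form.
Proof. by move=> hx hy hz; rewrite !rpredD ?formZ ?formM1. Qed.

Lemma frame_quadric x y z q : frame x y z -> q \is 2.-form ->
  exists a b c d e f, q = quadric_in x y z a b c d e f.
Proof.
move=> F /(frameS F)[p0 [p1 [p2 [h0 h1 h2 ->]]]].
have [_ _ _ h] := F.
have [a0 [a1 [a2 ->]]] := h _ h0.
have [b0 [b1 [b2 ->]]] := h _ h1.
have [c0 [c1 [c2 ->]]] := h _ h2.
by exists a0, (a1 + b0), (a2 + c0), b1, (b2 + c1), c2; rewrite /quadric_in; ring.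
Qed.

Lemma frame_yxz x y z : frame x y z -> frame y x z.
Proof.
move=> F; have [hx hy hz _] := F; apply: (frame_sub F) => //.
- by exists 0, 1, 0; rewrite !rmorph0 !rmorph1; ring.
- by exists 1, 0, 0; rewrite !rmorph0 !rmorph1; ring.
- by exists 0, 0, 1; rewrite !rmorph0 !rmorph1; ring.
Qed.

Lemma frame_xzy x y z : frame x y z -> frame x z y.
Proof.
move=> F; have [hx hy hz _] := F; apply: (frame_sub F) => //.
- by exists 1, 0, 0; rewrite !rmorph0 !rmorph1; ring.
- by exists 0, 0, 1; rewrite !rmorph0 !rmorph1; ring.
- by exists 0, 1, 0; rewrite !rmorph0 !rmorph1; ring.
Qed.

Lemma frame_replace x y z a b c : frame x y z -> a != 0 ->
  frame (a%:K * x + b%:K * y + c%:K * z) y z.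
Proof.
move=> F a0; have [hx hy hz _] := F.
apply: (frame_sub F) => //; rewrite ?rpredD ?formZ//.
- exists a^-1, (- (b / a)), (- (c / a)).
  have aV : a^-1%:K * a%:K = 1 :> S by rewrite -rmorphM mulVf// rmorph1.
  rewrite -[x in LHS]mul1r -aV; ring.
- by exists 0, 1, 0; rewrite !rmorph0 !rmorph1; ring.
- by exists 0, 0, 1; rewrite !rmorph0 !rmorph1; ring.
Qed.

Lemma frame_ext1 x : x \is 1.-form -> x != 0 -> exists y z, frame x y z.
Proof.
have [_ _ _ h] := frameX => /h[a [b [c ->]]] x0.
have [a0|a0] := eqVneq a 0; last by exists (X 1), (X 2); exact/frame_replace/a0/frameX.
have [b0|b0] := eqVneq b 0; last first.
  exists (X 0), (X 2).
  by rewrite [_ + b%:K * _]addrC; apply/frame_replace/b0/frame_yxz/frameX.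
have [c0|c0] := eqVneq c 0.
  by move: x0; rewrite a0 b0 c0 !rmorph0 !mul0r !addr0 eqxx.
exists (X 0), (X 1); rewrite addrC addrA.
exact/frame_replace/c0/frame_yxz/frame_xzy/frameX.
Qed.

Definition indep2 x y := forall c d, c%:K * x + d%:K * y = 0 -> c = 0 /\ d = 0.

Lemma frame_ext2 x y : x \is 1.-form -> y \is 1.-form -> indep2 x y ->
  exists z, frame x y z.
Proof.
move=> hx hy xy; have x0 : x != 0.
  apply/eqP => x0; have [] := xy 1 0; first by rewrite x0 rmorph0; ring.
  by move/eqP; rewrite oner_eq0.
have [y1 [z1 F]] := frame_ext1 hx x0; have [_ _ _ /(_ _ hy)[a [b [c yE]]]] := F.
have [b0|b0] := eqVneq b 0; last first.
  exists z1; apply: frame_yxz; rewrite yE [a%:K * _ + _]addrC.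
  exact/frame_replace/b0/frame_yxz.
have [c0|c0] := eqVneq c 0.
  have [] := xy a (-1); first by rewrite yE b0 c0 rmorphN rmorph0 rmorph1; ring.
  by move=> _ /eqP; rewrite oppr_eq0 oner_eq0.
exists y1; apply: frame_yxz; rewrite yE addrC addrA.
exact/frame_replace/c0/frame_yxz/frame_xzy.
Qed.

(** A square matrix with a left inverse also has a right one, so generators of a space of
    dimension three are coordinates. *)
Lemma frame_matrix x y z : frame x y z -> exists A B : 'M[R]_3,
  [/\ A *m B = 1%:M,
      forall i, tnth [tuple x; y; z] i = \sum_j (A i j)%:K * X j &
      forall i, X i = \sum_j (B i j)%:K * tnth [tuple x; y; z] j].
Proof.
move=> [hx hy hz h].
have [_ _ _ hX] := frameX.
pose u : 'I_3 -> S := tnth [tuple x; y; z].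
have hu i : u i \is 1.-form by case: i => -[|[|[|//]]] ? /=.
have toX i : exists w : 'rV[R]_3, u i = \sum_j (w 0 j)%:K * X j.
  have [c0 [c1 [c2 ->]]] := hX _ (hu i).
  exists (\row_j tnth [tuple c0; c1; c2] j).
  by rewrite !big_ord_recl big_ord0 !mxE addr0 !addrA; congr (_ + _ + _);
    congr (_ * mpolyX _ (mnm1 _)); apply: val_inj.
have ofX i : exists w : 'rV[R]_3, X i = \sum_j (w 0 j)%:K * u j.
  have [c0 [c1 [c2 ->]]] := h _ (formX i).
  exists (\row_j tnth [tuple c0; c1; c2] j).
  by rewrite !big_ord_recl big_ord0 !mxE addr0 !addrA.
have /fin_all_exists[A AE] := toX.
have /fin_all_exists[B BE] := ofX.
(* The coordinate functions are separated by evaluation at the unit points, which turns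
   the two polynomial identities into BA = 1. *)
exists (\matrix_(i, j) A i 0 j), (\matrix_(i, j) B i 0 j); split.
- apply: mulmx1C; apply/matrixP => i j; rewrite !mxE.
  pose e k := (k == j)%:R : R.
  have := congr1 (meval e) (BE i); rewrite mevalXU [LHS]/e => ->.
  rewrite rmorph_sum /=; apply: eq_bigr => k _.
  rewrite mevalM mevalC !mxE; congr (_ * _).
  rewrite AE rmorph_sum (bigD1 j)//= mevalM mevalC mevalXU /e eqxx mulr1.
  by rewrite big1 ?addr0// => l lj; rewrite mevalM mevalXU (negPf lj) mulr0.
- by move=> i; rewrite -/(u i) AE; apply: eq_bigr => j _; rewrite mxE.
- by move=> i; rewrite BE; apply: eq_bigr => j _; rewrite mxE.
Qed.

Lemma frame_point x y z (r s t : R) : frame x y z ->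
  exists v, [/\ meval v x = r, meval v y = s & meval v z = t].
Proof.
move=> /frame_matrix[A [B [AB AE _]]].
pose c := \col_j tnth [tuple r; s; t] j.
pose v j := (B *m c) j 0; exists v.
have uE i : meval v (tnth [tuple x; y; z] i) = c i 0.
  rewrite AE rmorph_sum /= -[c in RHS]mul1mx -AB -mulmxA mxE.
  by apply: eq_bigr => j _; rewrite mevalM mevalC mevalXU.
by split; [have := uE 0|have := uE 1|have := uE 2]; rewrite mxE.
Qed.

(** Linearly independent linear forms have only the Koszul syzygy: on the line y = 0 the
    relation reads p x = 0, so p vanishes there and is divisible by y. *)
Lemma linear_syzygy_factor x y p q : p \is 2.-form -> q \is 2.-form ->
  x \is 1.-form -> y \is 1.-form -> indep2 x y ->
  p * x + q * y = 0 -> exists2 b, b \is 1.-form & p = b * y /\ q = - (b * x).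
Proof.
move=> hp hq hx hy xy pq.
have [z F] := frame_ext2 hx hy xy.
have [a [b [c [d [e [f pE]]]]]] := frame_quadric F hp.
have ev t : a + c * t + f * t ^+ 2 = 0.
  have [v [v1 v2 v3]] := frame_point 1 0 t F.
  have := congr1 (meval v) pq.
  rewrite pE /quadric_in !(mevalD, mevalM) v1 v2 v3 !mevalC => ev.
  rewrite -ev; ring.
have a0 : a = 0 by have := ev 0; lra.
have f0 : f = 0 by have := ev 1; have := ev (-1); lra.
have c0 : c = 0 by have := ev 1; have := ev (-1); lra.
have [_ _ hz _] := F.
exists (b%:K * x + d%:K * y + e%:K * z); first by rewrite !rpredD ?formZ.
have pE' : p = (b%:K * x + d%:K * y + e%:K * z) * y.
  by rewrite pE a0 c0 f0 /quadric_in !rmorph0; ring.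
split=> //; move: pq; rewrite pE' => pq.
have y0 : y != 0.
  apply/eqP => y0; have [] := xy 0 1; first by rewrite y0 rmorph0; ring.
  by move=> _ /eqP; rewrite oner_eq0.
apply: (mulIf y0); apply/eqP; rewrite -subr_eq0; apply/eqP; rewrite -pq; ring.
Qed.

End Frames.

(** * Nets of quadrics satisfying the second-order condition *)

Section Net.
Variables (R : rcfType) (L : {scalar mpoly 3 R}).
Local Notation S := (mpoly 3 R).
Implicit Types (p q x y z w u : S) (a b c : R).

Lemma scalar_mpolyCM c p : L (c%:K * p) = c * L p.
Proof. by rewrite mul_mpolyC linearZ. Qed.

(** The kernel of the bilinear form (q, q') |-> L(q q') on quadrics. *)
Definition annihilator q := forall p, p \is 2.-form -> L (q * p) = 0.

Definition psd_on_squares := forall q, q \is 2.-form -> 0 <= L (q * q).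

Lemma annihD p q : annihilator p -> annihilator q -> annihilator (p + q).
Proof. by move=> hp hq r hr; rewrite mulrDl linearD hp// hq// addr0. Qed.

Lemma annihZ c p : annihilator p -> annihilator (c%:K * p).
Proof. by move=> hp r hr; rewrite -mulrA scalar_mpolyCM hp// mulr0. Qed.

Lemma annihN p : annihilator p -> annihilator (- p).
Proof. by move=> hp r hr; rewrite mulNr linearN hp// oppr0. Qed.

Lemma annihZK c p : c != 0 -> annihilator (c%:K * p) -> annihilator p.
Proof.
move=> c0 hp r /hp; rewrite -mulrA scalar_mpolyCM => /eqP.
by rewrite mulf_eq0 (negPf c0) => /eqP.
Qed.

Definition indep3 u0 u1 u2 := forall a b c,
  a%:K * u0 + b%:K * u1 + c%:K * u2 = 0 -> [/\ a = 0, b = 0 & c = 0].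

(** The moments of L in the coordinates x, y, z; they determine the Gram matrix of the
    form L(q q') in the monomials of degree two. *)
Definition moment x y z (i j k : nat) := L (x ^+ i * y ^+ j * z ^+ k).

Lemma moment_quadric x y z a b c (d e f : R) a' b' c' (d' e' f' : R) :
  L (quadric_in x y z a b c d e f * quadric_in x y z a' b' c' d' e' f') =
  a * a' * moment x y z 4 0 0
  + (a * b' + b * a') * moment x y z 3 1 0 + (a * c' + c * a') * moment x y z 3 0 1
  + (a * d' + d * a' + b * b') * moment x y z 2 2 0
  + (a * e' + e * a' + b * c' + c * b') * moment x y z 2 1 1
  + (a * f' + f * a' + c * c') * moment x y z 2 0 2
  + (b * d' + d * b') * moment x y z 1 3 0
  + (b * e' + e * b' + c * d' + d * c') * moment x y z 1 2 1
  + (b * f' + f * b' + c * e' + e * c') * moment x y z 1 1 2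
  + (c * f' + f * c') * moment x y z 1 0 3
  + d * d' * moment x y z 0 4 0 + (d * e' + e * d') * moment x y z 0 3 1
  + (d * f' + f * d' + e * e') * moment x y z 0 2 2
  + (e * f' + f * e') * moment x y z 0 1 3 + f * f' * moment x y z 0 0 4.
Proof.
transitivity (L (
  (a * a')%:K * (x ^+ 4 * y ^+ 0 * z ^+ 0)
  + (a * b' + b * a')%:K * (x ^+ 3 * y ^+ 1 * z ^+ 0)
  + (a * c' + c * a')%:K * (x ^+ 3 * y ^+ 0 * z ^+ 1)
  + (a * d' + d * a' + b * b')%:K * (x ^+ 2 * y ^+ 2 * z ^+ 0)
  + (a * e' + e * a' + b * c' + c * b')%:K * (x ^+ 2 * y ^+ 1 * z ^+ 1)
  + (a * f' + f * a' + c * c')%:K * (x ^+ 2 * y ^+ 0 * z ^+ 2)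
  + (b * d' + d * b')%:K * (x ^+ 1 * y ^+ 3 * z ^+ 0)
  + (b * e' + e * b' + c * d' + d * c')%:K * (x ^+ 1 * y ^+ 2 * z ^+ 1)
  + (b * f' + f * b' + c * e' + e * c')%:K * (x ^+ 1 * y ^+ 1 * z ^+ 2)
  + (c * f' + f * c')%:K * (x ^+ 1 * y ^+ 0 * z ^+ 3)
  + (d * d')%:K * (x ^+ 0 * y ^+ 4 * z ^+ 0)
  + (d * e' + e * d')%:K * (x ^+ 0 * y ^+ 3 * z ^+ 1)
  + (d * f' + f * d' + e * e')%:K * (x ^+ 0 * y ^+ 2 * z ^+ 2)
  + (e * f' + f * e')%:K * (x ^+ 0 * y ^+ 1 * z ^+ 3)
  + (f * f')%:K * (x ^+ 0 * y ^+ 0 * z ^+ 4))).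
  by congr (L _); rewrite /quadric_in; ring.
by rewrite !linearD !scalar_mpolyCM.
Qed.

(** The six equations are the products with xx, xy, xz, yy, yz and zz. *)
Lemma annih_quadric x y z a b c (d e f : R) : frame x y z ->
  annihilator (quadric_in x y z a b c d e f) <->
  [/\ a * moment x y z 4 0 0 + b * moment x y z 3 1 0 + c * moment x y z 3 0 1
        + d * moment x y z 2 2 0 + e * moment x y z 2 1 1 + f * moment x y z 2 0 2 = 0,
      a * moment x y z 3 1 0 + b * moment x y z 2 2 0 + c * moment x y z 2 1 1
        + d * moment x y z 1 3 0 + e * moment x y z 1 2 1 + f * moment x y z 1 1 2 = 0 &
      a * moment x y z 3 0 1 + b * moment x y z 2 1 1 + c * moment x y z 2 0 2
        + d * moment x y z 1 2 1 + e * moment x y z 1 1 2 + f * moment x y z 1 0 3 = 0] /\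
  [/\ a * moment x y z 2 2 0 + b * moment x y z 1 3 0 + c * moment x y z 1 2 1
        + d * moment x y z 0 4 0 + e * moment x y z 0 3 1 + f * moment x y z 0 2 2 = 0,
      a * moment x y z 2 1 1 + b * moment x y z 1 2 1 + c * moment x y z 1 1 2
        + d * moment x y z 0 3 1 + e * moment x y z 0 2 2 + f * moment x y z 0 1 3 = 0 &
      a * moment x y z 2 0 2 + b * moment x y z 1 1 2 + c * moment x y z 1 0 3
        + d * moment x y z 0 2 2 + e * moment x y z 0 1 3 + f * moment x y z 0 0 4 = 0].
Proof.
move=> F; have [hx hy hz _] := F; split => [h|[[h1 h2 h3] [h4 h5 h6]] p hp].
- have E a' b' c' d' e' f' := h _ (form_quadric_in a' b' c' d' e' f' hx hy hz).
  have E1 := E 1 0 0 0 0 0; have E2 := E 0 1 0 0 0 0; have E3 := E 0 0 1 0 0 0.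
  have E4 := E 0 0 0 1 0 0; have E5 := E 0 0 0 0 1 0; have E6 := E 0 0 0 0 0 1.
  rewrite moment_quadric in E1; rewrite moment_quadric in E2.
  rewrite moment_quadric in E3; rewrite moment_quadric in E4.
  rewrite moment_quadric in E5; rewrite moment_quadric in E6.
  split; split.
  + by rewrite -[RHS]E1; ring.
  + by rewrite -[RHS]E2; ring.
  + by rewrite -[RHS]E3; ring.
  + by rewrite -[RHS]E4; ring.
  + by rewrite -[RHS]E5; ring.
  + by rewrite -[RHS]E6; ring.
- have [a' [b' [c' [d' [e' [f' ->]]]]]] := frame_quadric F hp.
  rewrite moment_quadric.
  transitivity (a' * 0 + b' * 0 + c' * 0 + d' * 0 + e' * 0 + f' * (0 : R)); last by ring.
  rewrite -{1}h1 -{1}h2 -{1}h3 -{1}h4 -{1}h5 -{1}h6; ring.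
Qed.

(** What a critical point with linearly independent l0, l1, l2 knows about L: the syzygies
    of the net are the directions in which the square of the derivative of sigma
    disappears from the second-order condition. The last clause is the principle that an
    isotropic vector of a positive semidefinite form is in its kernel. *)
Definition second_order_net l0 l1 l2 :=
  [/\ [/\ l0 \is 2.-form, l1 \is 2.-form & l2 \is 2.-form],
      [/\ annihilator l0, annihilator l1 & annihilator l2],
      indep3 l0 l1 l2 &
      forall y0 y1 y2, y0 \is 2.-form -> y1 \is 2.-form -> y2 \is 2.-form ->
        l0 * y0 + l1 * y1 + l2 * y2 = 0 ->
        0 <= L (y0 * y0 + y1 * y1 + y2 * y2) /\
        (L (y0 * y0 + y1 * y1 + y2 * y2) = 0 ->
         [/\ annihilator y0, annihilator y1 & annihilator y2])].

Variables l0 l1 l2 : S.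

Definition net_basis u0 u1 u2 :=
  [/\ lincomb3 l0 l1 l2 u0, lincomb3 l0 l1 l2 u1, lincomb3 l0 l1 l2 u2 & indep3 u0 u1 u2].

Hypothesis N : second_order_net l0 l1 l2.

Lemma net_form u : lincomb3 l0 l1 l2 u -> u \is 2.-form.
Proof.
by case: N => -[h0 h1 h2] _ _ _ [a [b [c ->]]]; rewrite !rpredD ?formZ.
Qed.

Lemma net_annih u : lincomb3 l0 l1 l2 u -> annihilator u.
Proof.
by case: N => _ [h0 h1 h2] _ _ [a [b [c ->]]]; do !apply: annihD; apply: annihZ.
Qed.

Lemma net_lincomb u0 u1 u2 u : lincomb3 l0 l1 l2 u0 -> lincomb3 l0 l1 l2 u1 ->
  lincomb3 l0 l1 l2 u2 -> lincomb3 u0 u1 u2 u -> lincomb3 l0 l1 l2 u.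
Proof.
move=> [a0 [a1 [a2 u0E]]] [b0 [b1 [b2 u1E]]] [c0 [c1 [c2 u2E]]] [e0 [e1 [e2 ->]]].
rewrite u0E u1E u2E; exists (e0 * a0 + e1 * b0 + e2 * c0),
  (e0 * a1 + e1 * b1 + e2 * c1), (e0 * a2 + e1 * b2 + e2 * c2); ring.
Qed.

Lemma net_basis_perm u0 u1 u2 : net_basis u0 u1 u2 -> net_basis u1 u2 u0.
Proof.
move=> [h0 h1 h2 h]; split=> // a b c E.
by have [] := h c a b; first by rewrite -E; ring.
Qed.

Lemma net_basis_lin2 u0 u1 u2 a b c (d : R) : a * d - b * c != 0 -> net_basis u0 u1 u2 ->
  net_basis (a%:K * u0 + b%:K * u1) (c%:K * u0 + d%:K * u1) u2.
Proof.
move=> D [h0 h1 h2 h]; split=> //.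
- by apply: (net_lincomb h0 h1 h2); exists a, b, 0; rewrite rmorph0; ring.
- by apply: (net_lincomb h0 h1 h2); exists c, d, 0; rewrite rmorph0; ring.
- move=> s t r E; have [] := h (s * a + t * c) (s * b + t * d) r.
    by rewrite -E; ring.
  move=> E1 E2 ->; split=> //; apply: (mulIf D); rewrite mul0r.
    transitivity (d * (s * a + t * c) - c * (s * b + t * d)); first by ring.
    by rewrite E1 E2; ring.
  transitivity (a * (s * b + t * d) - b * (s * a + t * c)); first by ring.
  by rewrite E1 E2; ring.
Qed.

Lemma net_basis_shift u0 u1 u2 a b c : c != 0 -> net_basis u0 u1 u2 ->
  net_basis u0 u1 (a%:K * u0 + b%:K * u1 + c%:K * u2).
Proof.
move=> c0 [h0 h1 h2 h]; split=> //.
- by apply: (net_lincomb h0 h1 h2); exists a, b, c.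
- move=> s t r E; have [] := h (s + r * a) (t + r * b) (r * c).
    by rewrite -E; ring.
  move=> E1 E2 /eqP; rewrite mulf_eq0 (negPf c0) orbF => /eqP r0.
  by move: E1 E2; rewrite r0 !mul0r !addr0.
Qed.

Lemma net_basis_self : net_basis l0 l1 l2.
Proof.
case: N => _ _ h _; split=> //.
- by exists 1, 0, 0; rewrite !rmorph0 !rmorph1; ring.
- by exists 0, 1, 0; rewrite !rmorph0 !rmorph1; ring.
- by exists 0, 0, 1; rewrite !rmorph0 !rmorph1; ring.
Qed.

(** A family of three independent vectors in the span of three vectors has an invertible
    coefficient matrix. *)
Lemma net_basis_sym u0 u1 u2 : net_basis u0 u1 u2 ->
  [/\ lincomb3 u0 u1 u2 l0, lincomb3 u0 u1 u2 l1 & lincomb3 u0 u1 u2 l2].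
Proof.
move=> [[a0 [a1 [a2 E0]]] [b0 [b1 [b2 E1]]] [c0 [c1 [c2 E2]]] ind].
pose A : 'M[R]_3 := \matrix_(i, j)
  tnth [tuple tnth [tuple a0; a1; a2] j; tnth [tuple b0; b1; b2] j;
              tnth [tuple c0; c1; c2] j] i.
pose u := tnth [tuple u0; u1; u2]; pose l := tnth [tuple l0; l1; l2].
have sum3 (F : 'I_3 -> S) : \sum_i F i = F 0 + F 1 + F 2.
  rewrite !big_ord_recl big_ord0 addr0 addrA.
  by congr (F _ + F _ + F _); apply: val_inj.
have uE i : u i = \sum_j (A i j)%:K * l j.
  by rewrite sum3 !mxE; case: i => -[|[|[|//]]] hi; rewrite /u /l/= ?(E0, E1, E2).
have Au : A \in unitmx.
  rewrite -row_free_unit -kermx_eq0; apply/rowV0P => v /sub_kermxP vA.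
  have [] := ind (v 0 0) (v 0 1) (v 0 2).
    rewrite -(sum3 (fun i => (v 0 i)%:K * u i)).
    transitivity (\sum_j ((v *m A) 0 j)%:K * l j); last first.
      by rewrite vA big1// => j _; rewrite mxE rmorph0 mul0r.
    under eq_bigr do rewrite uE mulr_sumr.
    rewrite exchange_big; apply: eq_bigr => j _.
    rewrite mxE rmorph_sum mulr_suml; apply: eq_bigr => i _.
    by rewrite rmorphM mulrA.
  move=> e0 e1 e2; apply/rowP => i; rewrite mxE.
  by case: i => -[|[|[|//]]] hi; [rewrite -[RHS]e0|rewrite -[RHS]e1|rewrite -[RHS]e2];
    congr (v _ _); apply: val_inj.
have lE i : l i = \sum_j (invmx A i j)%:K * u j.
  transitivity (\sum_k ((invmx A *m A) i k)%:K * l k).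
    rewrite mulVmx// (bigD1 i)//= mxE eqxx rmorph1 mul1r big1 ?addr0// => j ji.
    by rewrite mxE eq_sym (negPf ji) rmorph0 mul0r.
  under [RHS]eq_bigr do rewrite uE mulr_sumr.
  rewrite exchange_big; apply: eq_bigr => j _.
  rewrite mxE rmorph_sum mulr_suml; apply: eq_bigr => h _.
  by rewrite rmorphM mulrA.
by split; [have := lE 0|have := lE 1|have := lE 2]; rewrite sum3 => E; do 3!eexists; exact: E.
Qed.

(** If u = A l, a syzygy y of u is the syzygy A^T y of l, and sum (A^T y)_j^2 is the
    quadratic form of the Gram matrix A A^T at y. An entry in the kernel contributes
    nothing, which leaves the upper left 2 x 2 block (p, q; q, r), positive definite since
    u0 and u1 are independent. *)
Lemma two_entry_syzygy u0 u1 u2 : net_basis u0 u1 u2 -> exists p q r : R,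
  [/\ 0 < p, 0 < r, q ^+ 2 < p * r & forall y0 y1 y2,
    y0 \is 2.-form -> y1 \is 2.-form -> y2 \is 2.-form ->
    u0 * y0 + u1 * y1 + u2 * y2 = 0 -> annihilator y2 ->
    let Q := p * L (y0 * y0) + 2 * q * L (y0 * y1) + r * L (y1 * y1) in
    0 <= Q /\ (Q = 0 -> annihilator y0 /\ annihilator y1)].
Proof.
move=> [[a0 [a1 [a2 u0E]]] [b0 [b1 [b2 u1E]]] [c0 [c1 [c2 u2E]]] h].
pose p := a0 ^+ 2 + a1 ^+ 2 + a2 ^+ 2; pose q := a0 * b0 + a1 * b1 + a2 * b2.
pose r := b0 ^+ 2 + b1 ^+ 2 + b2 ^+ 2.
have D : q ^+ 2 < p * r.
  (* Lagrange's identity. *)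
  rewrite -subr_gt0; have -> : p * r - q ^+ 2 = (a0 * b1 - a1 * b0) ^+ 2 +
    (a0 * b2 - a2 * b0) ^+ 2 + (a1 * b2 - a2 * b1) ^+ 2 by rewrite /p /q /r; ring.
  rewrite lt_neqAle eq_sym !addr_ge0 ?sqr_ge0// andbT.
  apply/eqP => /eqP; rewrite paddr_eq0 ?addr_ge0 ?sqr_ge0// paddr_eq0 ?sqr_ge0//.
  rewrite !sqrf_eq0 !subr_eq0 => /andP[/andP[/eqP E01 /eqP E02] /eqP E12].
  have u1N0 : b0 = 0 -> b1 = 0 -> b2 = 0 -> False.
    move=> e0 e1 e2; have [] := h 0 1 0.
      by rewrite u1E e0 e1 e2 !rmorph0 rmorph1; ring.
    by move=> _ /eqP; rewrite oner_eq0.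
  have key s t : s * a0 + t * b0 = 0 -> s * a1 + t * b1 = 0 -> s * a2 + t * b2 = 0 ->
      s = 0 /\ t = 0.
    move=> e0 e1 e2; have [] // := h s t 0.
    rewrite u0E u1E; transitivity ((s * a0 + t * b0)%:K * l0 +
      (s * a1 + t * b1)%:K * l1 + (s * a2 + t * b2)%:K * l2); last first.
      by rewrite e0 e1 e2 rmorph0; ring.
    by rewrite rmorph0; ring.
  have [|||b00 a00] := key b0 (- a0); [lra|lra|lra|].
  have [|||b10 a10] := key b1 (- a1); [lra|lra|lra|].
  have [|||b20 a20] := key b2 (- a2); [lra|lra|lra|].
  exact: u1N0.
have pge : 0 <= p by rewrite !addr_ge0 ?sqr_ge0.
have rge : 0 <= r by rewrite !addr_ge0 ?sqr_ge0.
have q2 := sqr_ge0 q.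
exists p, q, r; split => //.
- by rewrite lt_neqAle pge andbT eq_sym; apply/eqP => p0; move: D; rewrite p0; lra.
- by rewrite lt_neqAle rge andbT eq_sym; apply/eqP => r0; move: D; rewrite r0; lra.
move=> y0 y1 y2 h0 h1 h2 E A2.
(* The entries of A^T y. *)
pose v0 := a0%:K * y0 + b0%:K * y1 + c0%:K * y2.
pose v1 := a1%:K * y0 + b1%:K * y1 + c1%:K * y2.
pose v2 := a2%:K * y0 + b2%:K * y1 + c2%:K * y2.
have hv0 : v0 \is 2.-form by rewrite !rpredD ?formZ.
have hv1 : v1 \is 2.-form by rewrite !rpredD ?formZ.
have hv2 : v2 \is 2.-form by rewrite !rpredD ?formZ.
have Ev : l0 * v0 + l1 * v1 + l2 * v2 = 0.
  by rewrite -E u0E u1E u2E /v0 /v1 /v2; ring.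
have -> : p * L (y0 * y0) + 2 * q * L (y0 * y1) + r * L (y1 * y1) =
    L (v0 * v0 + v1 * v1 + v2 * v2).
  transitivity (L (p%:K * (y0 * y0) + (2 * q)%:K * (y0 * y1) + r%:K * (y1 * y1) +
     y2 * ((2 * (a0 * c0 + a1 * c1 + a2 * c2))%:K * y0 +
           (2 * (b0 * c0 + b1 * c1 + b2 * c2))%:K * y1 +
           (c0 ^+ 2 + c1 ^+ 2 + c2 ^+ 2)%:K * y2))).
    by rewrite linearD A2 ?rpredD ?formZ// addr0 !linearD !scalar_mpolyCM.
  by congr (L _); rewrite /p /q /r /v0 /v1 /v2; ring.
have [_ _ _ l_syz] := N.
have [ge0 eq0] := l_syz _ _ _ hv0 hv1 hv2 Ev; split=> // /eq0[A_0 A_1 A_2].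
have D0 : p * r - q ^+ 2 != 0 by rewrite gt_eqF// subr_gt0.
(* The 2 x 2 block times (y0, y1) is in the kernel, and the block is invertible. *)
have P0 : annihilator (p%:K * y0 + q%:K * y1).
  have -> : p%:K * y0 + q%:K * y1 = a0%:K * v0 + a1%:K * v1 + a2%:K * v2 +
     (- (a0 * c0 + a1 * c1 + a2 * c2))%:K * y2 by rewrite /p /q /v0 /v1 /v2; ring.
  by do !apply: annihD; apply: annihZ.
have P1 : annihilator (q%:K * y0 + r%:K * y1).
  have -> : q%:K * y0 + r%:K * y1 = b0%:K * v0 + b1%:K * v1 + b2%:K * v2 +
     (- (b0 * c0 + b1 * c1 + b2 * c2))%:K * y2 by rewrite /q /r /v0 /v1 /v2; ring.
  by do !apply: annihD; apply: annihZ.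
split; apply: (annihZK D0).
- have -> : (p * r - q ^+ 2)%:K * y0 = r%:K * (p%:K * y0 + q%:K * y1) +
    (- q)%:K * (q%:K * y0 + r%:K * y1) by ring.
  by apply: annihD; apply: annihZ.
- have -> : (p * r - q ^+ 2)%:K * y1 = (- q)%:K * (p%:K * y0 + q%:K * y1) +
    p%:K * (q%:K * y0 + r%:K * y1) by ring.
  by apply: annihD; apply: annihZ.
Qed.

(** This is how signs of L are obtained: exhibit q as the first entry of a syzygy whose
    other entries are in the kernel. *)
Lemma one_entry_syzygy u0 u1 u2 y0 y1 y2 : net_basis u0 u1 u2 ->
    y0 \is 2.-form -> y1 \is 2.-form -> y2 \is 2.-form ->
    u0 * y0 + u1 * y1 + u2 * y2 = 0 -> annihilator y1 -> annihilator y2 ->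
    0 <= L (y0 * y0).
Proof.
move=> /two_entry_syzygy[p [q [r [p0 r0 _ h]]]] h0 h1 h2 E A1 A2.
have [] := h _ _ _ h0 h1 h2 E A2.
by rewrite [y0 * y1]mulrC !A1// !mulr0 !addr0 pmulr_rge0.
Qed.

End Net.

(** * Nets containing a pencil with a transversal common factor *)

Section PencilNet.
Variables (R : rcfType) (L : {scalar mpoly 3 R}).
Local Notation S := (mpoly 3 R).
Implicit Types (p q x y z w u : S) (a b c : R).
Variables l0 l1 l2 : S.
Hypothesis N : second_order_net L l0 l1 l2.
Local Notation net_basis := (net_basis l0 l1 l2).
Local Notation moment := (moment L).
Local Notation annihilator := (annihilator L).

Lemma frame_lin2 x y z a b c (d : R) : a * d - b * c != 0 -> frame x y z ->
  frame (a%:K * x + b%:K * y) (c%:K * x + d%:K * y) z.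
Proof.
move=> D F; have [hx hy hz _] := F.
have DV : (a * d - b * c)^-1%:K * (a%:K * d%:K - b%:K * c%:K) = 1 :> S.
  by rewrite -!rmorphM -rmorphB -rmorphM mulVf// rmorph1.
set e := (a * d - b * c)^-1 in DV.
apply: (frame_sub F) => //; rewrite ?rpredD ?formZ//.
- exists (e * d), (- (e * b)), 0.
  by rewrite -[x in LHS]mul1r -DV !rmorph0; ring.
- exists (- (e * c)), (e * a), 0.
  by rewrite -[y in LHS]mul1r -DV !rmorph0; ring.
- by exists 0, 0, 1; rewrite !rmorph0 !rmorph1; ring.
Qed.

(** Modulo the net, which is the degree two part of the ideal of x, any quadric is a
    quadric g = y n + z n'. The syzygy x^2 g = xy (x n) + xz (x n') has its last two
    entries in the net. *)
Lemma psd_common_factor x y z : frame x y z ->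
  net_basis (x * x) (x * y) (x * z) -> psd_on_squares L.
Proof.
move=> F B; have [hx hy hz _] := F; have [s0 s1 s2 _] := B.
have A0 := net_annih N s0; have A1 := net_annih N s1; have A2 := net_annih N s2.
move=> q /(frame_quadric F)[a [b [c [d [e [f ->]]]]]].
pose n := d%:K * y + e%:K * z; pose n' := f%:K * z.
have hn : n \is 1.-form by rewrite rpredD ?formZ.
have hn' : n' \is 1.-form by rewrite formZ.
pose g := y * n + z * n'.
pose h := a%:K * (x * x) + b%:K * (x * y) + c%:K * (x * z).
have Ah : annihilator h by do !apply: annihD; apply: annihZ.
have hg : g \is 2.-form by rewrite rpredD ?formM1.
have -> : quadric_in x y z a b c d e f = h + g by rewrite /quadric_in /h /g /n /n'; ring.
have -> : L ((h + g) * (h + g)) = L (g * g).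
  have -> : (h + g) * (h + g) = h * (h + g + g) + g * g by ring.
  by rewrite linearD Ah ?add0r// !rpredD ?formZ ?formM1.
have annx m : m \is 1.-form -> annihilator (- (x * m)).
  case: F => _ _ _ /[apply] -[c0 [c1 [c2 ->]]]; apply: annihN.
  have -> : x * (c0%:K * x + c1%:K * y + c2%:K * z) =
    c0%:K * (x * x) + c1%:K * (x * y) + c2%:K * (x * z) by ring.
  by do !apply: annihD; apply: annihZ.
apply: (one_entry_syzygy N B (y1 := - (x * n)) (y2 := - (x * n'))); rewrite ?rpredN ?formM1//.
- by rewrite /g; ring.
- exact: annx.
- exact: annx.
Qed.

Section Transversal.
Variables x y z : S.
Hypothesis F : frame x y z.

(** For a net containing zx and zy, only the moments of binary quartics in x, y and that
    of z^4 survive. The product type makes the nine equations a single rewriting rule. *)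
Lemma annih_zx_zy : annihilator (z * x) -> annihilator (z * y) ->
  ((moment x y z 3 0 1 = 0) * (moment x y z 2 1 1 = 0) * (moment x y z 2 0 2 = 0) *
   (moment x y z 1 2 1 = 0) * (moment x y z 1 1 2 = 0) * (moment x y z 1 0 3 = 0) *
   (moment x y z 0 3 1 = 0) * (moment x y z 0 2 2 = 0) * (moment x y z 0 1 3 = 0))%type.
Proof.
have -> : z * x = quadric_in x y z 0 0 1 0 0 0 by rewrite /quadric_in !rmorph0 rmorph1; ring.
have -> : z * y = quadric_in x y z 0 0 0 0 1 0 by rewrite /quadric_in !rmorph0 rmorph1; ring.
move=> /(annih_quadric _ _ _ _ _ _ _ F)[[? ? ?] [? ? ?]].
move=> /(annih_quadric _ _ _ _ _ _ _ F)[[? ? ?] [? ? ?]].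
by do ![split]; lra.
Qed.

Section TransversalNet.
Variables a b d f : R.
Let w := quadric_in x y z a b 0 d 0 f.
Hypothesis B : net_basis (z * x) (z * y) w.

Let zeros := annih_zx_zy (let: And4 s0 _ _ _ := B in net_annih N s0)
  (let: And4 _ s1 _ _ := B in net_annih N s1).

(** The kernel condition for w: the binary part of w is apolar to the binary part of L. *)
Lemma transversal_relations :
  [/\ a * moment x y z 4 0 0 + b * moment x y z 3 1 0 + d * moment x y z 2 2 0 = 0,
      a * moment x y z 3 1 0 + b * moment x y z 2 2 0 + d * moment x y z 1 3 0 = 0,
      a * moment x y z 2 2 0 + b * moment x y z 1 3 0 + d * moment x y z 0 4 0 = 0 &
      f * moment x y z 0 0 4 = 0].
Proof.
have [_ _ s2 _] := B.
have /(annih_quadric _ _ _ _ _ _ _ F) := net_annih N s2.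
rewrite !zeros => -[[? ? ?] [? ? ?]]; split; lra.
Qed.

(** If f = 0, then w is in the ideal of x and y, and w z^2 is a combination of zx and zy
    with coefficients in the net. *)
Lemma transversal_vertex_ge0 : 0 <= moment x y z 0 0 4.
Proof.
have [_ _ _ /eqP] := transversal_relations; rewrite mulf_eq0.
case: (eqVneq f 0) => [f0 _|_ /= /eqP->//].
have [hx hy hz _] := F; have [s0 s1 _ _] := B.
have A0 := net_annih N s0; have A1 := net_annih N s1.
have -> : moment x y z 0 0 4 = L (z * z * (z * z)).
  by rewrite /moment; congr (L _); ring.
apply: (one_entry_syzygy N (net_basis_perm (net_basis_perm B)) (y0 := z * z)
  (y1 := - (a%:K * (z * x) + b%:K * (z * y))) (y2 := - (d%:K * (z * y)))).
- exact: formM1.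
- by rewrite rpredN rpredD ?formZ ?formM1.
- by rewrite rpredN formZ ?formM1.
- by rewrite /w f0 /quadric_in !rmorph0; ring.
- by apply: annihN; apply: annihD; apply: annihZ.
- by apply: annihN; apply: annihZ.
Qed.

(** The Koszul syzygy zx (y n) = zy (x n), with n = s x + t y. *)
Lemma transversal_form : exists p q r : R, [/\ 0 < p, 0 < r & forall s t : R,
  let Q :=
    p * (s ^+ 2 * moment x y z 2 2 0 + 2 * s * t * moment x y z 1 3 0
         + t ^+ 2 * moment x y z 0 4 0)
    - 2 * q * (s ^+ 2 * moment x y z 3 1 0 + 2 * s * t * moment x y z 2 2 0
         + t ^+ 2 * moment x y z 1 3 0)
    + r * (s ^+ 2 * moment x y z 4 0 0 + 2 * s * t * moment x y z 3 1 0
         + t ^+ 2 * moment x y z 2 2 0) in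
  0 <= Q /\ (Q = 0 -> annihilator (quadric_in x y z 0 s 0 t 0 0) /\
                      annihilator (quadric_in x y z s t 0 0 0 0))].
Proof.
have [p [q [r [p0 r0 _ h]]]] := two_entry_syzygy N B.
have [hx hy hz _] := F.
exists p, q, r; split=> // s t.
have := h (quadric_in x y z 0 s 0 t 0 0) (- quadric_in x y z s t 0 0 0 0) 0.
rewrite rpred0 rpredN !form_quadric_in// => /(_ isT isT isT) [].
- by rewrite /quadric_in !rmorph0; ring.
- by move=> ? _; rewrite mul0r linear0.
rewrite mulrN mulrNN linearN /= !moment_quadric => hQ hQ0.
split=> [|Q0].
  by move: hQ; congr (0 <= _); ring.
have [] := hQ0; first by rewrite -[RHS]Q0; ring.
by move=> ? /annihN; rewrite opprK.
Qed.

Lemma transversal_psd :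
  (forall s t u : R, 0 <= s ^+ 2 * moment x y z 4 0 0 + 2 * s * t * moment x y z 3 1 0
     + (2 * s * u + t ^+ 2) * moment x y z 2 2 0 + 2 * t * u * moment x y z 1 3 0
     + u ^+ 2 * moment x y z 0 4 0) -> psd_on_squares L.
Proof.
move=> H q /(frame_quadric F)[s [t [? [u [? [v ->]]]]]].
rewrite moment_quadric !zeros.
have := H s t u; have := mulr_ge0 (sqr_ge0 v) transversal_vertex_ge0.
by move=> E1 E2; have := addr_ge0 E1 E2; congr (0 <= _); ring.
Qed.

End TransversalNet.

(** Binary part xy: L is supported on x^4, y^4 and z^4, and the Koszul syzygies with n = x
    and n = y make the first two moments nonnegative. *)
Lemma transversal_split (b f : R) : b != 0 ->
  net_basis (z * x) (z * y) (quadric_in x y z 0 b 0 0 0 f) -> psd_on_squares L.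
Proof.
move=> b0 B; have [r1 r2 r3 _] := transversal_relations B.
have [p [q [r [p0 r0 h]]]] := transversal_form B.
have m310 : moment x y z 3 1 0 = 0 by apply: (mulfI b0); lra.
have m220 : moment x y z 2 2 0 = 0 by apply: (mulfI b0); lra.
have m130 : moment x y z 1 3 0 = 0 by apply: (mulfI b0); lra.
have [h1 _] := h 1 0; have [h2 _] := h 0 1.
move: h1 h2; rewrite m310 m220 m130 => h1 h2.
have m400 : 0 <= moment x y z 4 0 0 by rewrite -(pmulr_rge0 _ r0); lra.
have m040 : 0 <= moment x y z 0 4 0 by rewrite -(pmulr_rge0 _ p0); lra.
apply: (transversal_psd B) => s t u; rewrite m310 m220 m130.
have := mulr_ge0 (sqr_ge0 s) m400; have := mulr_ge0 (sqr_ge0 u) m040; lra.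
Qed.

(** Binary part x^2: apolarity leaves the moments of x y^3 and y^4. The Koszul syzygy with
    n = x is isotropic, so its entries xy and x^2 are in the kernel; this kills the moment
    of x y^3. *)
Lemma transversal_double (b f : R) : b != 0 ->
  net_basis (z * x) (z * y) (quadric_in x y z b 0 0 0 0 f) -> psd_on_squares L.
Proof.
move=> b0 B; have [r1 r2 r3 _] := transversal_relations B.
have [p [q [r [p0 r0 h]]]] := transversal_form B.
have m400 : moment x y z 4 0 0 = 0 by apply: (mulfI b0); lra.
have m310 : moment x y z 3 1 0 = 0 by apply: (mulfI b0); lra.
have m220 : moment x y z 2 2 0 = 0 by apply: (mulfI b0); lra.
have [_ h1] := h 1 0; have [h2 _] := h 0 1.
move: h1 h2; rewrite m400 m310 m220 => h1 h2.
have [|/(annih_quadric _ _ _ _ _ _ _ F)[[_ _ _] [e _ _]] _] := h1; first by lra.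
have m130 : moment x y z 1 3 0 = 0 by lra.
move: h2; rewrite m130 => h2.
have m040 : 0 <= moment x y z 0 4 0 by rewrite -(pmulr_rge0 _ p0); lra.
apply: (transversal_psd B) => s t u; rewrite m400 m310 m220 m130.
have := mulr_ge0 (sqr_ge0 u) m040; lra.
Qed.

(** Binary part x^2 + y^2: the binary part of L is harmonic, so the values at n = x and
    n = y of the form of [transversal_form] are opposite. Both vanish, the corresponding
    entries are in the kernel, and the binary part of L is zero. *)
Lemma transversal_definite (b f : R) : b != 0 ->
  net_basis (z * x) (z * y) (quadric_in x y z b 0 0 b 0 f) -> psd_on_squares L.
Proof.
move=> b0 B; have [r1 r2 r3 _] := transversal_relations B.
have [p [q [r [p0 r0 h]]]] := transversal_form B.
have e1 : moment x y z 4 0 0 + moment x y z 2 2 0 = 0 by apply: (mulfI b0); lra.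
have e2 : moment x y z 3 1 0 + moment x y z 1 3 0 = 0 by apply: (mulfI b0); lra.
have e3 : moment x y z 2 2 0 + moment x y z 0 4 0 = 0 by apply: (mulfI b0); lra.
have E1 : moment x y z 2 2 0 = - moment x y z 4 0 0 by lra.
have E2 : moment x y z 1 3 0 = - moment x y z 3 1 0 by lra.
have E3 : moment x y z 0 4 0 = moment x y z 4 0 0 by lra.
move: h; rewrite E1 E2 E3 => h.
have [h1 h1'] := h 1 0; have [h2 h2'] := h 0 1.
have [|_ /(annih_quadric _ _ _ _ _ _ _ F)[[e4 e5 _] _]] := h1'.
  by apply/eqP; rewrite eq_le h1 andbT; lra.
have m400 : moment x y z 4 0 0 = 0 by lra.
have m310 : moment x y z 3 1 0 = 0 by lra.
apply: (transversal_psd B) => s t u; rewrite E1 E2 E3 m400 m310; lra.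
Qed.

End Transversal.

End PencilNet.

(** * Nets containing a pencil whose common factor belongs to it *)

Section TangentNet.
Variables (R : rcfType) (L : {scalar mpoly 3 R}).
Local Notation S := (mpoly 3 R).
Implicit Types (p q x y z w u : S) (a b c : R).
Variables l0 l1 l2 : S.
Hypothesis N : second_order_net L l0 l1 l2.
Local Notation net_basis := (net_basis l0 l1 l2).
Local Notation moment := (moment L).
Local Notation annihilator := (annihilator L).

Lemma transversal_lin2 x y z w a b c (d : R) : a * d - b * c != 0 ->
  frame x y z -> net_basis (z * x) (z * y) w ->
  frame (a%:K * x + b%:K * y) (c%:K * x + d%:K * y) z /\
  net_basis (z * (a%:K * x + b%:K * y)) (z * (c%:K * x + d%:K * y)) w.
Proof.
move=> D F B; split; first exact: frame_lin2.
have := net_basis_lin2 D B; congr (net_basis _ _ _); ring.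
Qed.

(** Modulo zx and zy, the third quadric is the sum of a binary quadric and a multiple of
    z^2, and the binary quadric is brought to one of the forms xy, x^2, x^2 + y^2 up to a
    scalar by completing the square. If it is zero, the net is the degree two part of the
    ideal of z. *)
Lemma transversal_psd_net x y z w : frame x y z -> net_basis (z * x) (z * y) w ->
  psd_on_squares L.
Proof.
move=> F B; have [_ _ s2 _] := B.
have [a [b [c [d [e [f wE]]]]]] := frame_quadric F (net_form N s2).
have {}B : net_basis (z * x) (z * y) (quadric_in x y z a b 0 d 0 f).
  have := net_basis_shift (- c) (- e) (oner_neq0 _) B; congr (net_basis _ _ _).
  by rewrite wE /quadric_in !rmorphN !rmorph0 rmorph1; ring.
move: B => {wE s2 w c e} B.
have [a0|a0] := eqVneq a 0.
  have [d0|d0] := eqVneq d 0.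
    have [b0|b0] := eqVneq b 0; last by move: B; rewrite a0 d0; apply: transversal_split.
    have f0 : f != 0.
      apply/eqP => f0; have [_ _ _ /(_ 0 0 1)[]] := B; last by move=> _ _ /eqP; rewrite oner_eq0.
      by rewrite a0 b0 d0 f0 /quadric_in !rmorph0; ring.
    apply: (@psd_common_factor _ _ _ _ _ N z x y); first exact/frame_yxz/frame_xzy.
    apply: net_basis_perm; apply: net_basis_perm.
    have fV : f^-1 != 0 by rewrite invr_eq0.
    have := net_basis_shift 0 0 fV B; congr (net_basis _ _ _).
    have E : f^-1%:K * f%:K = 1 :> S by rewrite -rmorphM mulVf// rmorph1.
    by rewrite -[z * z]mul1r -E a0 b0 d0 /quadric_in !rmorph0; ring.
  have [b0|b0] := eqVneq b 0.
    have D : 0 * 0 - 1 * 1 != 0 :> R by rewrite mulr0 mulr1 sub0r oppr_eq0 oner_eq0.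
    have [F' B'] := transversal_lin2 D F B.
    apply: (transversal_double N F' d0 (f := f)); move: B'; congr (net_basis _ _ _).
    by rewrite a0 b0 /quadric_in !rmorph0 !rmorph1; ring.
  have D : b * 1 - d * 0 != 0 by rewrite mulr1 mulr0 subr0.
  have [F' B'] := transversal_lin2 D F B.
  apply: (transversal_split N F' (oner_neq0 _) (f := f)); move: B'; congr (net_basis _ _ _).
  by rewrite a0 /quadric_in !rmorph0 !rmorph1; ring.
(* a x^2 + b x y + d y^2 = a ((x + t y)^2 + D y^2); the sign of D selects the normal
   form. *)
pose t := b / (2 * a); pose D := d / a - t ^+ 2.
have bE : b = 2 * a * t by rewrite /t; field.
have dE : d = a * t ^+ 2 + a * D by rewrite /D; field.
have [D0|D0|D0] := ltrgt0P D.
- pose s := Num.sqrt D; have sD : D = s ^+ 2 by rewrite sqr_sqrtr ?ltW.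
  have s0 : 1 * s - t * 0 != 0 by rewrite mul1r mulr0 subr0 gt_eqF// sqrtr_gt0.
  have [F' B'] := transversal_lin2 s0 F B.
  apply: (transversal_definite N F' a0 (f := f)); move: B'; congr (net_basis _ _ _).
  by rewrite bE dE sD /quadric_in !rmorph0 !rmorph1; ring.
- pose s := Num.sqrt (- D).
  have sD : D = - s ^+ 2 by rewrite sqr_sqrtr ?opprK// oppr_ge0 ltW.
  have s0 : 1 * (t + s) - (t - s) * 1 != 0.
    rewrite mul1r mulr1 (_ : _ - _ = 2 * s); last by ring.
    by rewrite mulf_neq0 ?pnatr_eq0// gt_eqF// sqrtr_gt0 oppr_gt0.
  have [F' B'] := transversal_lin2 s0 F B.
  apply: (transversal_split N F' a0 (f := f)); move: B'; congr (net_basis _ _ _).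
  by rewrite bE dE sD /quadric_in !rmorph0 !rmorph1; ring.
- have s0 : 1 * 1 - t * 0 != 0 by rewrite mul1r mulr0 subr0 oner_neq0.
  have [F' B'] := transversal_lin2 s0 F B.
  apply: (transversal_double N F' a0 (f := f)); move: B'; congr (net_basis _ _ _).
  by rewrite bE dE D0 /quadric_in !rmorph0 !rmorph1; ring.
Qed.

(** The exceptional net: the second-order condition does not decide the sign of L on z^4,
    because the quadrics of the net are singular at the point x = y = 0. *)
Definition singular_net := exists x y z,
  [/\ frame x y z, net_basis (x * x) (x * y) (y * y) &
      [/\ moment x y z 1 0 3 = 0, moment x y z 0 1 3 = 0 & moment x y z 0 0 4 < 0]].

Section Tangent.
Variables (x y z : S) (c d e f : R).
Hypothesis F : frame x y z.
Let w := quadric_in x y z 0 0 c d e f.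
Hypothesis B : net_basis (x * x) (x * y) w.

(** For a net containing xx and xy, only the moments of x z^3 and of the binary quartics
    in y, z survive. The product type makes the nine equations a single rewriting rule. *)
Lemma annih_xx_xy :
  ((moment x y z 4 0 0 = 0) * (moment x y z 3 1 0 = 0) * (moment x y z 3 0 1 = 0) *
   (moment x y z 2 2 0 = 0) * (moment x y z 2 1 1 = 0) * (moment x y z 2 0 2 = 0) *
   (moment x y z 1 3 0 = 0) * (moment x y z 1 2 1 = 0) * (moment x y z 1 1 2 = 0))%type.
Proof.
have [s0 s1 _ _] := B; move: (net_annih N s0) (net_annih N s1).
have -> : x * x = quadric_in x y z 1 0 0 0 0 0 by rewrite /quadric_in !rmorph0 rmorph1; ring.
have -> : x * y = quadric_in x y z 0 1 0 0 0 0 by rewrite /quadric_in !rmorph0 rmorph1; ring.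
move=> /(annih_quadric _ _ _ _ _ _ _ F)[[? ? ?] [? ? ?]].
move=> /(annih_quadric _ _ _ _ _ _ _ F)[[? ? ?] [? ? ?]].
by do ![split]; lra.
Qed.

Lemma tangent_relations :
  [/\ f * moment x y z 1 0 3 = 0,
      d * moment x y z 0 4 0 + e * moment x y z 0 3 1 + f * moment x y z 0 2 2 = 0,
      d * moment x y z 0 3 1 + e * moment x y z 0 2 2 + f * moment x y z 0 1 3 = 0 &
      c * moment x y z 1 0 3 + d * moment x y z 0 2 2 + e * moment x y z 0 1 3
        + f * moment x y z 0 0 4 = 0].
Proof.
have [_ _ s2 _] := B.
have /(annih_quadric _ _ _ _ _ _ _ F) := net_annih N s2.
rewrite !annih_xx_xy => -[[? ? ?] [? ? ?]]; split; lra.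
Qed.

(** The Koszul syzygy xx (y n) = xy (x n), with n = s y + t z; the terms with x n vanish,
    so the form of the net reduces to L((y n)^2). *)
Lemma tangent_form (s t : R) :
  let Q := s ^+ 2 * moment x y z 0 4 0 + 2 * s * t * moment x y z 0 3 1
    + t ^+ 2 * moment x y z 0 2 2 in
  0 <= Q /\ (Q = 0 -> annihilator (quadric_in x y z 0 0 0 s t 0) /\
                      annihilator (quadric_in x y z 0 s t 0 0 0)).
Proof.
move=> Q; have [p [q [r [p0 r0 _ h]]]] := two_entry_syzygy N B.
have [hx hy hz _] := F.
have := h (quadric_in x y z 0 0 0 s t 0) (- quadric_in x y z 0 s t 0 0 0) 0.
rewrite rpred0 rpredN !form_quadric_in// => /(_ isT isT isT) [].
- by rewrite /quadric_in !rmorph0; ring.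
- by move=> ? _; rewrite mul0r linear0.
rewrite mulrN mulrNN linearN /= !moment_quadric !annih_xx_xy => hQ hQ0.
split=> [|Q0].
  move: hQ; set T := (X in 0 <= X); have -> : T = p * Q :> R by rewrite /T /Q; ring.
  by rewrite pmulr_rge0.
have [] := hQ0; first by transitivity (p * Q); [rewrite /Q; ring|rewrite Q0 mulr0].
by move=> ? /annihN; rewrite opprK.
Qed.

Lemma tangent_psd : moment x y z 1 0 3 = 0 ->
  (forall s t u : R, 0 <= s ^+ 2 * moment x y z 0 4 0 + 2 * s * t * moment x y z 0 3 1
     + (2 * s * u + t ^+ 2) * moment x y z 0 2 2 + 2 * t * u * moment x y z 0 1 3
     + u ^+ 2 * moment x y z 0 0 4) -> psd_on_squares L.
Proof.
move=> h0 H q /(frame_quadric F)[? [? [? [s [t [u ->]]]]]].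
rewrite moment_quadric h0 !annih_xx_xy.
by have := H s t u; congr (0 <= _); ring.
Qed.

(** If z^2 occurs in w, the moment of x z^3 vanishes and z^2 can be eliminated modulo w:
    any quadric in y and z is y n modulo the kernel, so [tangent_form] suffices. *)
Lemma tangent_net_zz : f != 0 -> psd_on_squares L.
Proof.
have [r0 r1 r2 r3] := tangent_relations => f0.
have s0 : moment x y z 1 0 3 = 0 by apply: (mulfI f0); rewrite r0 mulr0.
apply: (tangent_psd s0) => s t u.
pose k := u / f; have uE : u = k * f by rewrite /k divfK.
have [+ _] := tangent_form (s - k * d) (t - k * e).
congr (0 <= _).
rewrite -[LHS]addr0 -(mulr0 (- 2 * k * s)) -r1; move: r1 r2 r3.
rewrite s0 mulr0 add0r.
set m0 := moment _ _ _ 0 0 4; set m1 := moment _ _ _ 0 1 3.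
set m2 := moment _ _ _ 0 2 2; set m3 := moment _ _ _ 0 3 1.
set m4 := moment _ _ _ 0 4 0 => r1 r2 r3.
(* Expansion of the square of (s y^2 + t y z + u z^2) - k w; the terms with w vanish by
   the relations r1, r2, r3. *)
transitivity (s ^+ 2 * m4 + 2 * s * t * m3 + (2 * s * u + t ^+ 2) * m2 + 2 * t * u * m1
  + u ^+ 2 * m0 - 2 * k * (t - k * e) * (d * m3 + e * m2 + f * m1)
  - 2 * k * (s - k * d) * (d * m4 + e * m3 + f * m2)
  - k ^+ 2 * (d * (d * m4 + e * m3 + f * m2) + e * (d * m3 + e * m2 + f * m1)
     + f * (d * m2 + e * m1 + f * m0)) - 2 * k * s * (d * m4 + e * m3 + f * m2)); last first.
  by rewrite r1 r2 r3; ring.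
by rewrite uE; ring.
Qed.

End Tangent.

(** The relations make the syzygy with n = z isotropic, so xz and yz are in the kernel and
    only the moments of y^4 and z^4 remain. For the latter, w = (c x + y) z gives the
    syzygy (c x^2 + x y) z^2 = w (x z). *)
Lemma tangent_net_yz x y z c : frame x y z ->
  net_basis (x * x) (x * y) (quadric_in x y z 0 0 c 0 1 0) -> psd_on_squares L.
Proof.
move=> F B; have [hx hy hz _] := F; have [s0 s1 s2 _] := B.
have [_ r1 r2 r3] := tangent_relations F B.
have m031 : moment x y z 0 3 1 = 0 by lra.
have m022 : moment x y z 0 2 2 = 0 by lra.
have [_ h01] := tangent_form F B 0 1.
have [|_ Axz] := h01; first by rewrite m031 m022; ring.
have /(annih_quadric _ _ _ _ _ _ _ F)[[_ _ _] [_ _ m103]] := Axz.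
have {}m103 : moment x y z 1 0 3 = 0 by lra.
have m013 : moment x y z 0 1 3 = 0 by move: r3; rewrite m103; lra.
have [h10 _] := tangent_form F B 1 0.
have m040 : 0 <= moment x y z 0 4 0 by move: h10; rewrite m031 m022; lra.
have m004 : 0 <= moment x y z 0 0 4.
  have -> : moment x y z 0 0 4 = L (z * z * (z * z)) by rewrite /moment; congr (L _); ring.
  (* The basis c x^2 + x y, x^2, w of the net. *)
  have D : c * 0 - 1 * 1 != 0 by rewrite mulr0 mulr1 sub0r oppr_eq0 oner_eq0.
  apply: (one_entry_syzygy N (net_basis_lin2 D B) (y0 := z * z) (y1 := 0)
           (y2 := - (quadric_in x y z 0 0 1 0 0 0))).
  - exact: formM1.
  - exact: rpred0.
  - by rewrite rpredN form_quadric_in.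
  - by rewrite /quadric_in !rmorph0 !rmorph1; ring.
  - by move=> ? _; rewrite mul0r linear0.
  - exact: annihN.
apply: (tangent_psd F B m103) => s t u; rewrite m031 m022 m013.
have := mulr_ge0 (sqr_ge0 s) m040; have := mulr_ge0 (sqr_ge0 u) m004; lra.
Qed.

(** The syzygies with n = y and then n = z are isotropic, which kills all moments but that
    of z^4. If c is not zero, the syzygy x^2 (c z^2) + xy (d y z) = w (x z) makes it
    nonnegative; if c = 0, the net is <x^2, x y, y^2> and nothing bounds it from below. *)
Lemma tangent_net_yy x y z c (d : R) : frame x y z -> d != 0 ->
  net_basis (x * x) (x * y) (quadric_in x y z 0 0 c d 0 0) ->
  psd_on_squares L \/ singular_net.
Proof.
move=> F d0 B; have [hx hy hz _] := F; have [s0 s1 s2 _] := B.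
have [_ r1 r2 r3] := tangent_relations F B.
have m040 : moment x y z 0 4 0 = 0 by apply: (mulfI d0); lra.
have m031 : moment x y z 0 3 1 = 0 by apply: (mulfI d0); lra.
have [_ h10] := tangent_form F B 1 0.
have [|/(annih_quadric _ _ _ _ _ _ _ F)[[_ _ _] [_ _ m022]] _] := h10.
  by rewrite m040 m031; ring.
have {}m022 : moment x y z 0 2 2 = 0 by lra.
have [_ h01] := tangent_form F B 0 1.
have [|Ayz Axz] := h01; first by rewrite m031 m022; ring.
have /(annih_quadric _ _ _ _ _ _ _ F)[[_ _ _] [_ _ m013]] := Ayz.
have /(annih_quadric _ _ _ _ _ _ _ F)[[_ _ _] [_ _ m103]] := Axz.
have {}m103 : moment x y z 1 0 3 = 0 by lra.
have {}m013 : moment x y z 0 1 3 = 0 by lra.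
have psd : 0 <= moment x y z 0 0 4 -> psd_on_squares L.
  move=> m004; apply: (tangent_psd F B m103) => s t u; rewrite m040 m031 m022 m013.
  have := mulr_ge0 (sqr_ge0 u) m004; lra.
have [c0|c0] := eqVneq c 0; last first.
  left; apply: psd; have c2 : 0 < c ^+ 2 by rewrite lt_neqAle eq_sym sqrf_eq0 c0 sqr_ge0.
  have -> : moment x y z 0 0 4 = L (z * z * (z * z)) by rewrite /moment; congr (L _); ring.
  have E : L (c%:K * (z * z) * (c%:K * (z * z))) = c ^+ 2 * L (z * z * (z * z)).
    by rewrite -scalar_mpolyCM; congr (L _); ring.
  rewrite -(pmulr_rge0 _ c2) -E.
  apply: (one_entry_syzygy N B (y0 := c%:K * (z * z)) (y1 := d%:K * quadric_in x y z 0 0 0 0 1 0)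
           (y2 := - (quadric_in x y z 0 0 1 0 0 0))).
  - by rewrite formZ ?formM1.
  - by rewrite formZ ?form_quadric_in.
  - by rewrite rpredN form_quadric_in.
  - by rewrite /quadric_in !rmorph0 !rmorph1; ring.
  - exact: annihZ.
  - exact: annihN.
have [m004|m004] := leP 0 (moment x y z 0 0 4); first by left; apply: psd.
right; exists x, y, z; split=> //.
have dV : d^-1 != 0 by rewrite invr_eq0.
have := net_basis_shift 0 0 dV B; congr (net_basis _ _ _).
have E : d^-1%:K * d%:K = 1 :> S by rewrite -rmorphM mulVf// rmorph1.
by rewrite -[y * y]mul1r -E c0 /quadric_in !rmorph0; ring.
Qed.

(** Modulo x^2 and x y, the third quadric is w = c xz + d y^2 + e yz + f z^2. When f = 0
    and e is not zero, the term in y^2 is absorbed in z; when only c remains, the net is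
    the degree two part of the ideal of x. *)
Lemma tangent_net x y z w : frame x y z -> net_basis (x * x) (x * y) w ->
  psd_on_squares L \/ singular_net.
Proof.
move=> F B; have [_ _ s2 _] := B.
have [a [b [c [d [e [f wE]]]]]] := frame_quadric F (net_form N s2).
have {}B : net_basis (x * x) (x * y) (quadric_in x y z 0 0 c d e f).
  have := net_basis_shift (- a) (- b) (oner_neq0 _) B; congr (net_basis _ _ _).
  by rewrite wE /quadric_in !rmorphN !rmorph0 rmorph1; ring.
move: B => {wE s2 w a b} B.
have [f0|f0] := eqVneq f 0; last by left; apply: (tangent_net_zz F B).
have [e0|e0] := eqVneq e 0; last first.
  left; have F' : frame x y (e%:K * z + d%:K * y).
    have := frame_replace d 0 (frame_yxz (frame_xzy (frame_yxz F))) e0.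
    rewrite rmorph0 mul0r addr0 => F'.
    exact/frame_yxz/frame_xzy/frame_yxz.
  apply: (tangent_net_yz (c := c / e) F').
  have := net_basis_shift 0 (c / e * d) (oner_neq0 _) B; congr (net_basis _ _ _).
  have E : c%:K = (c / e)%:K * e%:K :> S by rewrite -rmorphM divfK.
  by rewrite f0 /quadric_in E !rmorph0 !rmorph1; ring.
have [d0|d0] := eqVneq d 0; last by move: B; rewrite e0 f0; apply: tangent_net_yy.
left; have c0 : c != 0.
  apply/eqP => c0; have [_ _ _ /(_ 0 0 1)[]] := B; last by move=> _ _ /eqP; rewrite oner_eq0.
  by rewrite c0 d0 e0 f0 /quadric_in !rmorph0; ring.
apply: (psd_common_factor N F).
have cV : c^-1 != 0 by rewrite invr_eq0.
have := net_basis_shift 0 0 cV B; congr (net_basis _ _ _).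
have E : c^-1%:K * c%:K = 1 :> S by rewrite -rmorphM mulVf// rmorph1.
by rewrite -[x * z]mul1r -E d0 e0 f0 /quadric_in !rmorph0; ring.
Qed.

End TangentNet.

(** * Nets containing a pencil and functionals supported at a point *)

Section PencilAndPoint.
Variables (R : rcfType) (L : {scalar mpoly 3 R}).
Local Notation S := (mpoly 3 R).
Implicit Types (p q x y z w u g m : S) (a b c : R).
Variables l0 l1 l2 : S.
Hypothesis N : second_order_net L l0 l1 l2.
Local Notation net_basis := (net_basis l0 l1 l2).
Local Notation moment := (moment L).
Local Notation annihilator := (annihilator L).
Local Notation dichotomy := (psd_on_squares L \/ singular_net L l0 l1 l2).

(** The two cases are distinguished by whether the common factor z is a combination of x
    and y; if it is, a change of basis of the pencil makes z one of the two. *)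
Lemma pencil_net x y z w : x \is 1.-form -> y \is 1.-form -> z \is 1.-form ->
  net_basis (z * x) (z * y) w -> dichotomy.
Proof.
move=> hx hy hz B.
have xy : indep2 x y.
  move=> c d E; have [_ _ _ /(_ c d 0)[]//] := B.
  by rewrite rmorph0; transitivity (z * (c%:K * x + d%:K * y)); [ring|rewrite E mulr0].
have [t F] := frame_ext2 hx hy xy.
have [_ _ _ /(_ _ hz)[a [b [c zE]]]] := F.
have [c0|c0] := eqVneq c 0; last first.
  left; apply: (transversal_psd_net N _ B); apply/frame_xzy/frame_yxz.
  have := frame_replace a b (frame_yxz (frame_xzy F)) c0.
  by have -> : c%:K * t + a%:K * x + b%:K * y = z by rewrite zE; ring.
have [a0|a0] := eqVneq a 0; last first.
  have D : a * 1 - b * 0 != 0 by rewrite mulr1 mulr0 subr0.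
  have := net_basis_lin2 D B; have := frame_lin2 D F.
  have -> : a%:K * x + b%:K * y = z by rewrite zE c0 rmorph0; ring.
  rewrite rmorph0 rmorph1 mul0r mul1r add0r => F'.
  have -> : a%:K * (z * x) + b%:K * (z * y) = z * z by rewrite {3}zE c0 rmorph0; ring.
  rewrite mul0r mul1r add0r; exact: (tangent_net N F').
have [b0|b0] := eqVneq b 0.
  have [_ _ _ /(_ 1 0 0)[]//] := B; last by move=> /eqP; rewrite oner_eq0.
  by rewrite zE a0 b0 c0 !rmorph0; ring.
have D : 0 * 0 - b * 1 != 0 by rewrite mulr1 mulr0 sub0r oppr_eq0.
have := net_basis_lin2 D B; have := frame_lin2 D F.
have -> : 0%:K * x + b%:K * y = z by rewrite zE a0 c0 rmorph0; ring.
rewrite rmorph0 rmorph1 !mul0r !mul1r addr0 => F'.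
have -> : 0 + b%:K * (z * y) = z * z by rewrite {3}zE a0 c0 rmorph0; ring.
rewrite addr0; exact: (tangent_net N F').
Qed.

Lemma net_basis_pivot u0 u1 u2 a b : net_basis u0 u1 u2 ->
  net_basis (a%:K * u0 + u1) (b%:K * u0 + u2) u0.
Proof.
move=> [h0 h1 h2 h]; split=> //.
- by apply: (net_lincomb h0 h1 h2); exists a, 1, 0; rewrite rmorph0 rmorph1; ring.
- by apply: (net_lincomb h0 h1 h2); exists b, 0, 1; rewrite rmorph0 rmorph1; ring.
- move=> s t r E; have [] := h (s * a + t * b + r) s t; first by rewrite -E; ring.
  by move=> E1 s0 t0; move: E1; rewrite s0 t0 !mul0r !add0r.
Qed.

(** If a net is spanned modulo z by one quadric g, then it meets the multiples of z in a
    pencil at least. *)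
Lemma line_net u0 u1 u2 z g m0 m1 m2 a b c : z \is 1.-form ->
  m0 \is 1.-form -> m1 \is 1.-form -> m2 \is 1.-form -> net_basis u0 u1 u2 ->
  u0 = z * m0 + a%:K * g -> u1 = z * m1 + b%:K * g -> u2 = z * m2 + c%:K * g ->
  dichotomy.
Proof.
move=> hz.
have pivot v0 v1 v2 n0 n1 n2 a' b' c' : n0 \is 1.-form -> n1 \is 1.-form ->
    n2 \is 1.-form -> net_basis v0 v1 v2 -> a' != 0 -> v0 = z * n0 + a'%:K * g ->
    v1 = z * n1 + b'%:K * g -> v2 = z * n2 + c'%:K * g -> dichotomy.
  move=> h0 h1 h2 B a0 E0 E1 E2; have := net_basis_pivot (- (b' / a')) (- (c' / a')) B.
  have -> : (- (b' / a'))%:K * v0 + v1 = z * ((- (b' / a'))%:K * n0 + n1).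
    have E : b'%:K = (b' / a')%:K * a'%:K :> S by rewrite -rmorphM divfK.
    by rewrite E0 E1 E; ring.
  have -> : (- (c' / a'))%:K * v0 + v2 = z * ((- (c' / a'))%:K * n0 + n2).
    have E : c'%:K = (c' / a')%:K * a'%:K :> S by rewrite -rmorphM divfK.
    by rewrite E0 E2 E; ring.
  by apply: pencil_net => //; rewrite rpredD ?formZ.
move=> h0 h1 h2 B E0 E1 E2.
have [a0|a0] := eqVneq a 0; last exact: (pivot _ _ _ _ _ _ _ _ _ h0 h1 h2 B a0 E0 E1 E2).
have [b0|b0] := eqVneq b 0; last first.
  exact: (pivot _ _ _ _ _ _ _ _ _ h1 h2 h0 (net_basis_perm B) b0 E1 E2 E0).
apply: (@pencil_net m0 m1 z u2) => //.
by move: B; rewrite E0 E1 a0 b0 rmorph0 mul0r !addr0.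
Qed.

Lemma frame_inv2 x y a b c (d : R) : a * d - b * c != 0 -> exists p q r s : R,
  x = p%:K * (a%:K * x + b%:K * y) + q%:K * (c%:K * x + d%:K * y) /\
  y = r%:K * (a%:K * x + b%:K * y) + s%:K * (c%:K * x + d%:K * y).
Proof.
move=> D.
have DV : (a * d - b * c)^-1%:K * (a%:K * d%:K - b%:K * c%:K) = 1 :> S.
  by rewrite -!rmorphM -rmorphB -rmorphM mulVf// rmorph1.
set e := (a * d - b * c)^-1 in DV.
exists (e * d), (- (e * b)), (- (e * c)), (e * a); split.
  by rewrite -[x in LHS]mul1r -DV; ring.
by rewrite -[y in LHS]mul1r -DV; ring.
Qed.

Lemma binary_change (x y x' y' : S) (p q r s a b d : R) :
  x = p%:K * x' + q%:K * y' -> y = r%:K * x' + s%:K * y' ->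
  exists a' b' d' : R, a%:K * (x * x) + b%:K * (x * y) + d%:K * (y * y) =
  a'%:K * (x' * x') + b'%:K * (x' * y') + d'%:K * (y' * y').
Proof.
move=> -> ->.
exists (a * p ^+ 2 + b * p * r + d * r ^+ 2),
  (2 * a * p * q + b * (p * s + q * r) + 2 * d * r * s),
  (a * q ^+ 2 + b * q * s + d * s ^+ 2); ring.
Qed.

Section OnePoint.
Variables x y z : S.
Hypothesis F : frame x y z.
Hypotheses (Axx : annihilator (x * x)) (Axy : annihilator (x * y)) (Axz : annihilator (x * z)).
Hypotheses (Ayy : annihilator (y * y)) (Ayz : annihilator (y * z)).

Lemma annih_ideal m m' : m \is 1.-form -> m' \is 1.-form -> annihilator (x * m + y * m').
Proof.
have [_ _ _ h] := F => /h[a [b [c ->]]] /h[a' [b' [c' ->]]].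
have -> : x * (a%:K * x + b%:K * y + c%:K * z) + y * (a'%:K * x + b'%:K * y + c'%:K * z)
  = a%:K * (x * x) + (b + a')%:K * (x * y) + c%:K * (x * z) + b'%:K * (y * y)
    + c'%:K * (y * z) by ring.
by do !apply: annihD; apply: annihZ.
Qed.

(** The functional L is here L(z^4) times the evaluation at the point x = y = 0, since the
    ideal of this point is in the kernel. *)
Lemma square_mod_ideal h (c : R) : h \is 2.-form -> annihilator h ->
  L ((c%:K * (z * z) + h) * (c%:K * (z * z) + h)) = c ^+ 2 * L (z * z * (z * z)).
Proof.
have [hx hy hz _] := F => hh Ah.
transitivity (L ((c ^+ 2)%:K * (z * z * (z * z)) + h * ((2 * c)%:K * (z * z) + h))).
  by congr (L _); ring.
by rewrite linearD Ah ?addr0 ?scalar_mpolyCM// rpredD// formZ ?formM1.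
Qed.

Lemma one_point_psd : 0 <= L (z * z * (z * z)) -> psd_on_squares L.
Proof.
have [hx hy hz _] := F => L0 q /(frame_quadric F)[a [b [c [d [e [f ->]]]]]].
pose m := a%:K * x + b%:K * y + c%:K * z; pose m' := d%:K * y + e%:K * z.
have hm : m \is 1.-form by rewrite !rpredD ?formZ.
have hm' : m' \is 1.-form by rewrite rpredD ?formZ.
have -> : quadric_in x y z a b c d e f = f%:K * (z * z) + (x * m + y * m').
  by rewrite /quadric_in /m /m'; ring.
have hh : x * m + y * m' \is 2.-form by rewrite rpredD ?formM1.
by rewrite (square_mod_ideal _ hh (annih_ideal hm hm')) mulr_ge0 ?sqr_ge0.
Qed.

(** Write the three quadrics as x A + y A', x C + y C' and x p + y q. Cramer's rule gives
    the syzygy with entries the 2 x 2 minors of this 3 x 2 matrix. The minor A C' - A' C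
    is z^2 modulo the ideal of x and y, while the two others are in this ideal, hence in
    the kernel. *)
Lemma one_point_normal_form (a0 b0 d0 a1 b1 d1 a b d : R) :
  net_basis (quadric_in x y z a0 b0 1 d0 0 0) (quadric_in x y z a1 b1 0 d1 1 0)
         (quadric_in x y z a b 0 d 0 0) -> psd_on_squares L.
Proof.
have [hx hy hz _] := F => B; apply: one_point_psd.
pose A := z + a0%:K * x + b0%:K * y; pose A' := d0%:K * y.
pose C := a1%:K * x + b1%:K * y; pose C' := z + d1%:K * y.
pose p := a%:K * x + b%:K * y; pose q := d%:K * y.
have hA : A \is 1.-form by rewrite !rpredD ?formZ.
have hA' : A' \is 1.-form by rewrite formZ.
have hC : C \is 1.-form by rewrite rpredD ?formZ.
have hC' : C' \is 1.-form by rewrite rpredD ?formZ.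
pose m := a0%:K * z + (a0 * d1)%:K * y - a1%:K * (d0%:K * y).
pose m' := d1%:K * z + b0%:K * z + (b0 * d1)%:K * y - b1%:K * (d0%:K * y).
have hm : m \is 1.-form by rewrite !(rpredD, rpredN) ?formZ.
have hm' : m' \is 1.-form by rewrite !(rpredD, rpredN) ?formZ.
have DE : A * C' - A' * C = 1%:K * (z * z) + (x * m + y * m').
  by rewrite /A /A' /C /C' /m /m' rmorph1; ring.
have hh : x * m + y * m' \is 2.-form by rewrite rpredD ?formM1.
have -> : L (z * z * (z * z)) = L ((A * C' - A' * C) * (A * C' - A' * C)).
  by rewrite DE (square_mod_ideal 1 hh (annih_ideal hm hm')) expr1n mul1r.
have hp : p \is 1.-form by rewrite rpredD ?formZ.
have hq : q \is 1.-form by rewrite formZ.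
apply: (one_entry_syzygy N (net_basis_perm (net_basis_perm B))
  (y1 := - (p * C' - q * C)) (y2 := - (q * A - p * A'))).
- by rewrite rpredB ?formM1.
- by rewrite rpredN rpredB ?formM1.
- by rewrite rpredN rpredB ?formM1.
- by rewrite /quadric_in /A /A' /C /C' /p /q !rmorph0 !rmorph1; ring.
- apply: annihN; have -> : p * C' - q * C = x * (a%:K * C') + y * (b%:K * C' - d%:K * C).
    by rewrite /p /q; ring.
  by apply: annih_ideal; rewrite ?rpredB ?formZ.
- apply: annihN; have -> : q * A - p * A' = x * (- (a%:K * A')) + y * (d%:K * A - b%:K * A').
    by rewrite /p /q; ring.
  by apply: annih_ideal; rewrite ?rpredN ?rpredB ?formZ.
Qed.

End OnePoint.

End PencilAndPoint.

(** * Functionals involving one or two variables *)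

Lemma collinear3 (R : rcfType) (c0 e0 c1 e1 c2 e2 : R) :
  c0 * e1 = e0 * c1 -> c0 * e2 = e0 * c2 -> c1 * e2 = e1 * c2 ->
  exists s t k0 k1 k2 : R, [/\ 0 < s ^+ 2 + t ^+ 2,
    c0 = k0 * s /\ e0 = k0 * t, c1 = k1 * s /\ e1 = k1 * t & c2 = k2 * s /\ e2 = k2 * t].
Proof.
have pos (s t : R) : (s != 0) || (t != 0) -> 0 < s ^+ 2 + t ^+ 2.
  move=> st; rewrite lt_neqAle addr_ge0 ?sqr_ge0// andbT eq_sym.
  by rewrite paddr_eq0 ?sqr_ge0// !sqrf_eq0 negb_and.
have main (s t c e : R) : (s != 0) || (t != 0) -> s * e = t * c ->
    exists k, c = k * s /\ e = k * t.
  move=> st E; have D := lt0r_neq0 (pos _ _ st).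
  exists ((c * s + e * t) / (s ^+ 2 + t ^+ 2)); split; apply: (mulIf D).
    rewrite mulrAC divfK//; transitivity (c * s * s + t * (t * c)); first ring.
    by rewrite -E; ring.
  rewrite mulrAC divfK//; transitivity (s * (s * e) + e * t * t); first ring.
  by rewrite E; ring.
move=> E01 E02 E12.
have [n0|n0] := boolP ((c0 != 0) || (e0 != 0)).
  have [k1 h1] := main _ _ _ _ n0 E01; have [k2 h2] := main _ _ _ _ n0 E02.
  by exists c0, e0, 1, k1, k2; rewrite !mul1r; split=> //; apply: pos.
move: n0; rewrite negb_or !negbK => /andP[/eqP-> /eqP->].
have [n1|n1] := boolP ((c1 != 0) || (e1 != 0)).
  have [k2 h2] := main _ _ _ _ n1 E12.
  by exists c1, e1, 0, 1, k2; rewrite !mul1r !mul0r; split=> //; apply: pos.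
move: n1; rewrite negb_or !negbK => /andP[/eqP-> /eqP->].
have [n2|n2] := boolP ((c2 != 0) || (e2 != 0)).
  by exists c2, e2, 0, 0, 1; rewrite !mul1r !mul0r; split=> //; apply: pos.
move: n2; rewrite negb_or !negbK => /andP[/eqP-> /eqP->].
by exists 1, 0, 0, 0, 0; rewrite !mul0r; split=> //; apply: pos; rewrite oner_neq0.
Qed.

(** Kernel of the Hankel matrix with rows (m4, m3, m2), (m3, m2, m1), (m2, m1, m0): if the
    first two or the last two rows are independent, the kernel lies on the line of their
    cross product. Otherwise the middle row vanishes or the rank is at most one, and these
    cases are explicit. *)
Lemma hankel_kernel (R : rcfType) (m4 m3 m2 m1 m0 : R) :
  (exists s t : R, [/\ (s != 0) || (t != 0), s * m4 + t * m3 = 0, s * m3 + t * m2 = 0,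
     s * m2 + t * m1 = 0 & s * m1 + t * m0 = 0]) \/
  (exists g0 g1 g2 : R, forall v0 v1 v2,
     v0 * m4 + v1 * m3 + v2 * m2 = 0 -> v0 * m3 + v1 * m2 + v2 * m1 = 0 ->
     v0 * m2 + v1 * m1 + v2 * m0 = 0 ->
     exists c, [/\ v0 = c * g0, v1 = c * g1 & v2 = c * g2]).
Proof.
have cross (g0 g1 g2 v0 v1 v2 : R) : [|| g0 != 0, g1 != 0 | g2 != 0] ->
    v0 * g1 = v1 * g0 -> v0 * g2 = v2 * g0 -> v1 * g2 = v2 * g1 ->
    exists c, [/\ v0 = c * g0, v1 = c * g1 & v2 = c * g2].
  have quot (a b c d : R) : d != 0 -> a * d = b * c -> a = b / d * c.
    by move=> d0 E; apply: (mulIf d0); rewrite E; field.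
  case/or3P => n E1 E2 E3.
  - by exists (v0 / g0); split; apply: quot.
  - by exists (v1 / g1); split; apply: quot.
  - by exists (v2 / g2); split; apply: quot.
have [k1|] := boolP [|| m3 * m1 - m2 ^+ 2 != 0, m2 * m3 - m4 * m1 != 0 | m4 * m2 - m3 ^+ 2 != 0].
  right; exists (m3 * m1 - m2 ^+ 2), (m2 * m3 - m4 * m1), (m4 * m2 - m3 ^+ 2).
  move=> v0 v1 v2 e1 e2 e3; apply: cross => //; apply/eqP; rewrite -subr_eq0; apply/eqP.
  - transitivity (m2 * (v0 * m3 + v1 * m2 + v2 * m1)
      - m1 * (v0 * m4 + v1 * m3 + v2 * m2));
      first by ring.
    by rewrite e1 e2; ring.
  - transitivity (- m3 * (v0 * m3 + v1 * m2 + v2 * m1)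
      + m2 * (v0 * m4 + v1 * m3 + v2 * m2));
      first by ring.
    by rewrite e1 e2; ring.
  - transitivity (m4 * (v0 * m3 + v1 * m2 + v2 * m1)
      - m3 * (v0 * m4 + v1 * m3 + v2 * m2));
      first by ring.
    by rewrite e1 e2; ring.
rewrite !negb_or !negbK => /and3P[/eqP a1 /eqP a2 /eqP a3].
have [k2|] := boolP [|| m2 * m0 - m1 ^+ 2 != 0, m1 * m2 - m3 * m0 != 0 | m3 * m1 - m2 ^+ 2 != 0].
  right; exists (m2 * m0 - m1 ^+ 2), (m1 * m2 - m3 * m0), (m3 * m1 - m2 ^+ 2).
  move=> v0 v1 v2 e1 e2 e3; apply: cross => //; apply/eqP; rewrite -subr_eq0; apply/eqP.
  - transitivity (m1 * (v0 * m2 + v1 * m1 + v2 * m0)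
      - m0 * (v0 * m3 + v1 * m2 + v2 * m1));
      first by ring.
    by rewrite e3 e2; ring.
  - transitivity (- m2 * (v0 * m2 + v1 * m1 + v2 * m0)
      + m1 * (v0 * m3 + v1 * m2 + v2 * m1));
      first by ring.
    by rewrite e3 e2; ring.
  - transitivity (m3 * (v0 * m2 + v1 * m1 + v2 * m0)
      - m2 * (v0 * m3 + v1 * m2 + v2 * m1));
      first by ring.
    by rewrite e3 e2; ring.
rewrite !negb_or !negbK => /and3P[/eqP a4 /eqP a5 _].
have [m30|m30] := eqVneq m3 0; last first.
  left; exists m3, (- m4); split; rewrite ?m30//; try lra.
  apply: (mulfI m30); rewrite mulr0.
  transitivity (- m1 * (m4 * m2 - m3 ^+ 2) + m4 * (m1 * m2 - m3 * m0)); first ring.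
  by rewrite a3 a5; ring.
have m20 : m2 = 0 by apply/eqP; rewrite -sqrf_eq0; apply/eqP; move: a1; rewrite m30; lra.
have m10 : m1 = 0 by apply/eqP; rewrite -sqrf_eq0; apply/eqP; move: a4; rewrite m20; lra.
rewrite m30 m20 m10.
have [m40|m40] := eqVneq m4 0.
  by left; exists 1, 0; rewrite oner_neq0 m40; split=> //; ring.
have [m00|m00] := eqVneq m0 0.
  by left; exists 0, 1; rewrite oner_neq0 m00 orbT; split=> //; ring.
right; exists 0, 1, 0 => v0 v1 v2 e1 _ e3; exists v1; split; rewrite ?mulr0 ?mulr1//.
- by apply: (mulIf m40); lra.
- by apply: (mulIf m00); lra.
Qed.

Section FewVariables.
Variables (R : rcfType) (L : {scalar mpoly 3 R}).
Local Notation S := (mpoly 3 R).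
Implicit Types (p q x y z w u g m : S) (a b c : R).
Variables l0 l1 l2 : S.
Hypothesis N : second_order_net L l0 l1 l2.
Local Notation net_basis := (net_basis l0 l1 l2).
Local Notation moment := (moment L).
Local Notation annihilator := (annihilator L).
Local Notation dichotomy := (psd_on_squares L \/ singular_net L l0 l1 l2).

Lemma binary_in_frame x y z a b c (d p q r : R) : a * d - b * c != 0 ->
  exists A B D : R, forall k l,
    quadric_in x y z p q (k * a + l * c) r (k * b + l * d) 0 =
    quadric_in (a%:K * x + b%:K * y) (c%:K * x + d%:K * y) z A B k D l 0.
Proof.
move=> /(frame_inv2 x y)[p' [q' [r' [s' [xE yE]]]]].
have [A [B [D E]]] := binary_change p q r xE yE.
exists A, B, D => k l; transitivity (p%:K * (x * x) + q%:K * (x * y) + r%:K * (y * y)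
   + (k%:K * (a%:K * x + b%:K * y) + l%:K * (c%:K * x + d%:K * y)) * z).
  by rewrite /quadric_in rmorph0; ring.
by rewrite E /quadric_in rmorph0; ring.
Qed.

(** Independent linear parts at the point x = y = 0 are taken as new coordinates;
    subtracting multiples of the first two quadrics kills the linear part of the third. *)
Lemma one_point_rank2 x y z
    (a0 b0 c0 d0 e0 a1 b1 c1 d1 e1 a2 b2 c2 d2 e2 : R) : frame x y z ->
  annihilator (x * x) -> annihilator (x * y) -> annihilator (x * z) ->
  annihilator (y * y) -> annihilator (y * z) -> c0 * e1 - e0 * c1 != 0 ->
  net_basis (quadric_in x y z a0 b0 c0 d0 e0 0) (quadric_in x y z a1 b1 c1 d1 e1 0)
         (quadric_in x y z a2 b2 c2 d2 e2 0) -> psd_on_squares L.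
Proof.
move=> F Axx Axy Axz Ayy Ayz D B; have [hx hy hz _] := F.
pose s := (e2 * c1 - c2 * e1) / (c0 * e1 - e0 * c1).
pose t := (e0 * c2 - c0 * e2) / (c0 * e1 - e0 * c1).
(* Cramer's rule: (s, t) expresses the third linear part through the first two. *)
have sc : s * c0 + t * c1 + c2 = 0 by rewrite /s /t; field.
have se : s * e0 + t * e1 + e2 = 0 by rewrite /s /t; field.
have {}B := net_basis_shift s t (oner_neq0 _) B.
have F' := frame_lin2 D F; have [hx' hy' _ _] := F'.
have Ann (p q : R) m : m \is 1.-form -> annihilator ((p%:K * x + q%:K * y) * m).
  move=> hm; have -> : (p%:K * x + q%:K * y) * m = x * (p%:K * m) + y * (q%:K * m) by ring.
  by apply: (annih_ideal F) => //; apply: formZ.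
have [A0 [B0 [D0 E0]]] := binary_in_frame x y z a0 b0 d0 D.
have [A1 [B1 [D1 E1]]] := binary_in_frame x y z a1 b1 d1 D.
have [A2 [B2 [D2 E2]]] := binary_in_frame x y z
  (s * a0 + t * a1 + a2) (s * b0 + t * b1 + b2) (s * d0 + t * d1 + d2) D.
have := E0 1 0; rewrite !mul1r !mul0r !addr0 => {}E0.
have := E1 0 1; rewrite !mul1r !mul0r !add0r => {}E1.
have := E2 0 0; rewrite !mul0r !addr0 => {}E2.
apply: (@one_point_normal_form _ _ _ _ _ N _ _ _ F' _ _ _ _ _ A0 B0 D0 A1 B1 D1 A2 B2 D2).
- exact: Ann.
- exact: Ann.
- exact: Ann.
- exact: Ann.
- exact: Ann.
- rewrite -E0 -E1 -E2; move: B; congr (net_basis _ _ _).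
  transitivity (quadric_in x y z (s * a0 + t * a1 + a2) (s * b0 + t * b1 + b2)
    (s * c0 + t * c1 + c2) (s * d0 + t * d1 + d2) (s * e0 + t * e1 + e2) 0).
    by rewrite /quadric_in !rmorph0 rmorph1; ring.
  by rewrite sc se.
Qed.

(** If L(z^4) < 0, all quadrics of the net vanish at the point x = y = 0. If their linear
    parts there are all multiples of one form s x + t y, the net is spanned modulo this
    form by the square of - t x + s y. *)
Lemma one_point_net x y z : frame x y z ->
  annihilator (x * x) -> annihilator (x * y) -> annihilator (x * z) ->
  annihilator (y * y) -> annihilator (y * z) -> dichotomy.
Proof.
move=> F Axx Axy Axz Ayy Ayz; have [hx hy hz _] := F.
have [L0|L0] := leP 0 (L (z * z * (z * z))).
  by left; apply: (one_point_psd F).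
have noz u : lincomb3 l0 l1 l2 u -> exists a b c d e : R, u = quadric_in x y z a b c d e 0.
  move=> s; have Au := net_annih N s.
  have [a [b [c [d [e [f uE]]]]]] := frame_quadric F (net_form N s).
  exists a, b, c, d, e; suff <- : f = 0 by [].
  pose m := a%:K * x + b%:K * y + c%:K * z; pose m' := d%:K * y + e%:K * z.
  have := Au _ (formM1 hz hz).
  have -> : u = x * m + y * m' + f%:K * (z * z).
    by rewrite uE /quadric_in /m /m'; ring.
  have hm : m \is 1.-form by rewrite !rpredD ?formZ.
  have hm' : m' \is 1.-form by rewrite rpredD ?formZ.
  rewrite mulrDl linearD (annih_ideal F Axx Axy Axz Ayy Ayz hm hm') ?formM1// add0r.
  rewrite -mulrA scalar_mpolyCM.
  by move/eqP; rewrite mulf_eq0 (lt_eqF L0) orbF => /eqP.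
have B := net_basis_self N; have [s0 s1 s2 _] := B.
have [a0 [b0 [c0 [d0 [e0 E0]]]]] := noz _ s0.
have [a1 [b1 [c1 [d1 [e1 E1]]]]] := noz _ s1.
have [a2 [b2 [c2 [d2 [e2 E2]]]]] := noz _ s2.
pose q0 := quadric_in x y z a0 b0 c0 d0 e0 0; pose q1 := quadric_in x y z a1 b1 c1 d1 e1 0.
pose q2 := quadric_in x y z a2 b2 c2 d2 e2 0.
have B' : net_basis q0 q1 q2 by rewrite /q0 /q1 /q2 -E0 -E1 -E2.
have [D01|D01] := eqVneq (c0 * e1 - e0 * c1) 0; last first.
  by left; apply: (one_point_rank2 F Axx Axy Axz Ayy Ayz D01 B').
have [D12|D12] := eqVneq (c1 * e2 - e1 * c2) 0; last first.
  by left; apply: (one_point_rank2 F Axx Axy Axz Ayy Ayz D12 (net_basis_perm B')).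
have [D20|D20] := eqVneq (c2 * e0 - e2 * c0) 0; last first.
  left; apply: (one_point_rank2 F Axx Axy Axz Ayy Ayz D20).
  exact/net_basis_perm/net_basis_perm/B'.
have [|||s [t [k0 [k1 [k2 [D [cE0 eE0] [cE1 eE1] [cE2 eE2]]]]]]] :=
  @collinear3 R c0 e0 c1 e1 c2 e2; try lra.
have D' : s * s - t * (- t) != 0 by rewrite mulrN opprK -!expr2 gt_eqF.
have F' := frame_lin2 D' F; have [hx' hy' _ _] := F'.
have key u a b c d e k : u = quadric_in x y z a b c d e 0 -> c = k * s -> e = k * t ->
  exists2 m, m \is 1.-form & exists d', u = (s%:K * x + t%:K * y) * m +
     d'%:K * (((- t)%:K * x + s%:K * y) * ((- t)%:K * x + s%:K * y)).
  move=> uE cE eE; have [A' [C' [D'' E]]] := binary_in_frame x y z a b d D'.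
  have := E k 0; rewrite !mul0r !addr0 -cE -eE -uE => {}E.
  exists (A'%:K * (s%:K * x + t%:K * y) + C'%:K * ((- t)%:K * x + s%:K * y) + k%:K * z).
    by rewrite !rpredD// ?formZ// rpredD ?formZ.
  by exists D''; rewrite E /quadric_in !rmorph0; ring.
have [m0 hm0 [d0' l0E]] := key _ _ _ _ _ _ _ E0 cE0 eE0.
have [m1 hm1 [d1' l1E]] := key _ _ _ _ _ _ _ E1 cE1 eE1.
have [m2 hm2 [d2' l2E]] := key _ _ _ _ _ _ _ E2 cE2 eE2.
exact: (line_net N hx' hm0 hm1 hm2 B l0E l1E l2E).
Qed.

(** The net modulo z lies in the kernel of the Hankel matrix of L. If this kernel contains
    the multiples of a linear form s x + t y, the functional L is concentrated at the
    point where z and s x + t y vanish. *)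
Lemma two_variable_net x y z : frame x y z ->
  annihilator (z * x) -> annihilator (z * y) -> annihilator (z * z) -> dichotomy.
Proof.
move=> F Azx Azy Azz; have [hx hy hz _] := F.
have B := net_basis_self N; have [s0 s1 s2 _] := B.
have zeros := annih_zx_zy F Azx Azy.
have [] := hankel_kernel (moment x y z 4 0 0) (moment x y z 3 1 0) (moment x y z 2 2 0)
  (moment x y z 1 3 0) (moment x y z 0 4 0).
  move=> [s [t [st e1 e2 e3 e4]]].
  have D : s * s - t * (- t) != 0.
    rewrite mulrN opprK -!expr2; move: st; apply: contraTneq => /eqP.
    by rewrite paddr_eq0 ?sqr_ge0// !sqrf_eq0 => /andP[/eqP-> /eqP->]; rewrite eqxx.
  have F' := frame_lin2 D F.
  have Anx : annihilator ((s%:K * x + t%:K * y) * x).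
    have -> : (s%:K * x + t%:K * y) * x = quadric_in x y z s t 0 0 0 0.
      by rewrite /quadric_in !rmorph0; ring.
    apply/(annih_quadric _ _ _ _ _ _ _ F); rewrite !zeros.
    by do ![split]; lra.
  have Any : annihilator ((s%:K * x + t%:K * y) * y).
    have -> : (s%:K * x + t%:K * y) * y = quadric_in x y z 0 s 0 t 0 0.
      by rewrite /quadric_in !rmorph0; ring.
    apply/(annih_quadric _ _ _ _ _ _ _ F); rewrite !zeros.
    by do ![split]; lra.
  apply: (@one_point_net (s%:K * x + t%:K * y) z ((- t)%:K * x + s%:K * y)).
  - exact: frame_xzy.
  - by rewrite mulrDr; apply: annihD; rewrite mulrCA; apply: annihZ.
  - have -> : (s%:K * x + t%:K * y) * z = s%:K * (z * x) + t%:K * (z * y) by ring.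
    by apply: annihD; apply: annihZ.
  - by rewrite mulrDr; apply: annihD; rewrite mulrCA; apply: annihZ.
  - exact: Azz.
  - by rewrite mulrDr; apply: annihD; rewrite mulrCA; apply: annihZ.
move=> [g0 [g1 [g2 ker]]].
have key u : lincomb3 l0 l1 l2 u -> exists2 m, m \is 1.-form & exists c : R,
    u = z * m + c%:K * quadric_in x y z g0 g1 0 g2 0 0.
  move=> s; have [a [b [c [d [e [f uE]]]]]] := frame_quadric F (net_form N s).
  have := net_annih N s; rewrite uE => /(annih_quadric _ _ _ _ _ _ _ F).
  rewrite !zeros => -[[q1 q2 _] [q3 _ _]].
  have [|||k [aE bE dE]] := ker a b d.
  - by rewrite -[RHS]q1; ring.
  - by rewrite -[RHS]q2; ring.
  - by rewrite -[RHS]q3; ring.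
  exists (c%:K * x + e%:K * y + f%:K * z); first by rewrite !rpredD ?formZ.
  by exists k; rewrite aE bE dE /quadric_in !rmorph0; ring.
have [m0 hm0 [c0 l0E]] := key _ s0.
have [m1 hm1 [c1 l1E]] := key _ s1.
have [m2 hm2 [c2 l2E]] := key _ s2.
exact: (line_net N hz hm0 hm1 hm2 B l0E l1E l2E).
Qed.

End FewVariables.

(** The determinant on a pencil of 3 x 3 matrices is a cubic form in two variables, which
    has a real zero. *)
Lemma singular_pencil (R : rcfType) (A B : 'M[R]_3) : exists a b (v : 'rV[R]_3),
  [/\ (a != 0) || (b != 0), v != 0 & v *m (a *: A + b *: B) = 0].
Proof.
have [uA|] := boolP (A \in unitmx).
  have [|r rt] := @odd_poly_root _ (char_poly (B *m invmx A)).
    by rewrite size_char_poly.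
  have /eigenvalueP[v vE v0] : eigenvalue (B *m invmx A) r.
    by rewrite eigenvalue_root_char.
  exists (- r), 1, v; split; rewrite ?oner_neq0 ?orbT// mulmxDr -!scalemxAr scale1r.
  by rewrite -(mulmxKV uA (v *m B)) -(mulmxA v B) vE -scalemxAl scaleNr addNr.
rewrite unitmxE unitfE negbK => /det0P[v v0 vA].
by exists 1, 0, v; rewrite oner_neq0; split=> //; rewrite scale1r scale0r addr0.
Qed.

(** * Linear syzygies and the dichotomy *)

Section GenericNet.
Variables (R : rcfType) (L : {scalar mpoly 3 R}).
Local Notation S := (mpoly 3 R).
Implicit Types (p q x y z w u g m : S) (a b c : R).
Variables l0 l1 l2 : S.
Hypothesis N : second_order_net L l0 l1 l2.
Local Notation net_basis := (net_basis l0 l1 l2).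
Local Notation moment := (moment L).
Local Notation annihilator := (annihilator L).
Local Notation dichotomy := (psd_on_squares L \/ singular_net L l0 l1 l2).

(** If the entries of a linear syzygy are dependent, a change of basis of the net makes
    one of them zero. A syzygy v1 x1 + v2 x2 = 0 then forces v1 = z x2 and v2 = - z x1. *)
Lemma degenerate_syzygy_net u0 u1 u2 x0 x1 x2 a b c : net_basis u0 u1 u2 ->
  x0 \is 1.-form -> x1 \is 1.-form -> x2 \is 1.-form ->
  u0 * x0 + u1 * x1 + u2 * x2 = 0 -> a%:K * x0 + b%:K * x1 + c%:K * x2 = 0 ->
  a != 0 -> [|| x0 != 0, x1 != 0 | x2 != 0] -> dichotomy.
Proof.
move=> B h0 h1 h2 E Ex a0 xN0.
have aV : a^-1%:K * a%:K = 1 :> S by rewrite -rmorphM mulVf// rmorph1.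
pose s := - (b / a); pose t := - (c / a).
have x0E : x0 = s%:K * x1 + t%:K * x2.
  apply/eqP; rewrite -subr_eq0; apply/eqP; rewrite -(mulr0 a^-1%:K) -Ex.
  by rewrite !mulrDr mulrA aV /s /t; ring.
have B' := net_basis_pivot s t B; have [_ _ _ ind] := B'.
have [c0 c1 _ _] := B'.
have E' : (s%:K * u0 + u1) * x1 + (t%:K * u0 + u2) * x2 = 0 by rewrite -E x0E; ring.
have x12 : (x1 != 0) || (x2 != 0).
  move: xN0; rewrite x0E; apply: contraTT; rewrite !negb_or !negbK.
  by move=> /andP[/eqP-> /eqP->]; rewrite !mulr0 addr0 eqxx.
have ind12 : indep2 x1 x2.
  have key (d e : R) p q y y' : d != 0 -> d%:K * y + e%:K * y' = 0 -> p * y + q * y' = 0 ->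
      (y != 0) || (y' != 0) -> (- e)%:K * p + d%:K * q = 0.
    move=> d0 D pq yy'; have y'0 : y' != 0.
      apply: contraTneq yy' => y'0; move: D; rewrite y'0 mulr0 addr0 eqxx orbF negbK.
      by rewrite mul_mpolyC => /eqP; rewrite scaler_eq0 (negPf d0).
    apply: (mulIf y'0); rewrite mul0r.
    transitivity (d%:K * (p * y + q * y') - p * (d%:K * y + e%:K * y')); first by ring.
    by rewrite pq D; ring.
  move=> d e D; have [d0|d0] := eqVneq d 0; last first.
    have ek := key _ _ _ _ _ _ d0 D E' x12.
    have [] := ind (- e) d 0; first by rewrite ek rmorph0; ring.
    by move=> _ d0'; rewrite d0' eqxx in d0.
  have [e0|e0] := eqVneq e 0; first by [].
  have ek : (- d)%:K * (t%:K * u0 + u2) + e%:K * (s%:K * u0 + u1) = 0.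
    apply: (key _ _ _ _ x2 x1 e0); first by rewrite addrC.
      by rewrite addrC.
    by rewrite orbC.
  have [] := ind e (- d) 0; first by rewrite -[RHS]ek rmorph0; ring.
  by move=> e0'; rewrite e0' eqxx in e0.
have [z hz [E1 E2]] := linear_syzygy_factor (net_form N c0) (net_form N c1) h1 h2 ind12 E'.
move: B'; rewrite E1 E2 -mulrN; apply: pencil_net => //; by rewrite rpredN.
Qed.

Definition linear_form (v : 'rV[R]_3) : S := \sum_i (v 0 i)%:K * X i.

Lemma linear_form_form v : linear_form v \is 1.-form.
Proof. by apply: rpred_sum => i _; apply: formZ; apply: formX. Qed.

Lemma linear_formD (v w : 'rV[R]_3) : linear_form (v + w) = linear_form v + linear_form w.
Proof.
rewrite /linear_form -big_split; apply: eq_bigr => i _.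
by rewrite mxE /=; ring.
Qed.

Lemma linear_formZ c (v : 'rV[R]_3) : linear_form (c *: v) = c%:K * linear_form v.
Proof.
rewrite /linear_form big_distrr; apply: eq_bigr => i _.
by rewrite mxE /=; ring.
Qed.

Lemma linear_form_eq0 v : linear_form v = 0 -> v = 0.
Proof.
move=> E; apply/rowP => i; rewrite mxE.
have := congr1 (meval (fun j => (j == i)%:R)) E.
rewrite /linear_form rmorph_sum rmorph0 (bigD1 i)//= mevalM mevalC mevalXU eqxx mulr1.
by rewrite big1 ?addr0// => j ji; rewrite mevalM mevalXU (negPf ji) mulr0.
Qed.

Let l_form : [/\ l0 \is 2.-form, l1 \is 2.-form & l2 \is 2.-form].
Proof. by case: N. Qed.

Let relation (A : 'M[R]_3) : S := l0 * linear_form (row 0 A)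
  + l1 * linear_form (row 1 A) + l2 * linear_form (row 2 A).

Let relation_form A : relation A \is 3.-form.
Proof.
have [f0 f1 f2] := l_form.
by rewrite !rpredD//; apply: (@dhomogM _ _ _ 2 _ 1) => //; apply: linear_form_form.
Qed.

Let relation_map (A : 'M[R]_3) : dhomog 3 R 3 := DHomog (relation_form A).

Let relation_map_linear : linear relation_map.
Proof.
move=> a A B; apply: val_inj => /=.
rewrite /relation !linearP /= !linear_formD !linear_formZ -mul_mpolyC; ring.
Qed.

HB.instance Definition _ := GRing.isLinear.Build _ _ _ _ relation_map relation_map_linear.

Let contraction (t : dhomog 3 R 3) : 'rV[R]_3 := \row_i L (val t * X i).

Let contraction_linear : linear contraction.
Proof.
by move=> a s t; apply/rowP => i; rewrite !mxE /= mulrDl linearD -scalerAl linearZ.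
Qed.

HB.instance Definition _ := GRing.isLinear.Build _ _ _ _ contraction contraction_linear.

(** If no linear form has its ideal in the kernel of L, then t |-> L(t -) maps the
    10-dimensional space of cubics onto the dual of the linear forms. The cubics
    l0 m0 + l1 m1 + l2 m2 are in its 7-dimensional kernel, so the map sending the 9
    coefficients of (m0, m1, m2) to this cubic has a kernel of dimension at least two. *)
Lemma two_linear_syzygies :
  (forall z, z \is 1.-form -> (forall m, m \is 1.-form -> annihilator (z * m)) -> z = 0) ->
  exists A B : 'M[R]_3,
    [/\ forall a b, a *: A + b *: B = 0 -> a = 0 /\ b = 0, relation A = 0 & relation B = 0].
Proof.
move=> ess; have [_ [A0 A1 A2] _ _] := N.
pose Phi := linfun relation_map; pose Psi := linfun contraction.
have sub : (limg Phi <= lker Psi)%VS.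
  apply/subvP => _ /memv_imgP[A _ ->]; rewrite memv_ker !lfunE /=; apply/eqP/rowP => i.
  rewrite !mxE /= /relation !mulrDl !linearD /= -!mulrA.
  by rewrite A0 ?A1 ?A2 ?addr0// formM1// ?linear_form_form ?formX.
have surj : \dim (limg Psi) = 3%N.
  have d3 : \dim {:'rV[R]_3} = 3%N by rewrite dimvf dim_matrix.
  apply/eqP; have := dimvS (subvf (limg Psi)); rewrite d3 eqn_leq => -> /=.
  rewrite leqNgt; apply/negP => small.
  pose M := \matrix_(i < \dim (limg Psi)) (vbasis (limg Psi))`_i.
  have /rowV0Pn[t /sub_kermxP tM t0] : kermx M^T != 0.
    rewrite kermx_eq0 -row_leq_rank -ltnNge.
    by apply: leq_ltn_trans small; rewrite mxrank_tr rank_leq_row.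
  have orth (s : dhomog 3 R 3) : t *m (contraction s)^T = 0.
    have : Psi s \in limg Psi by apply: memv_img; apply: memvf.
    rewrite lfunE /= => /coord_vbasis ->; rewrite linear_sum /= mulmx_sumr big1// => i _.
    rewrite linearZ /= -scalemxAr (_ : _`_i = row i M); last by rewrite rowK.
    by rewrite tr_row colE mulmxA tM mul0mx scaler0.
  (* A vector t orthogonal to the image of the contraction is a linear form whose ideal
     is killed by L. *)
  have z0 : linear_form t = 0.
    apply: ess; first exact: linear_form_form.
    move=> m hm q hq.
    have hmq : m * q \is 3.-form by apply: (@dhomogM _ _ _ 1 _ 2).
    have /matrixP/(_ 0 0) := orth (DHomog hmq).
    rewrite !mxE => E; rewrite -[RHS]E -mulrA /linear_form mulr_suml linear_sum.
    by apply: eq_bigr => i _; rewrite !mxE /= -mulrA scalar_mpolyCM [X i * _]mulrC.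
  by move: t0; rewrite (linear_form_eq0 z0) eqxx.
have dimK : (2 <= \dim (lker Phi))%N.
  have := limg_ker_dim Phi fullv; have := limg_ker_dim Psi fullv.
  rewrite !capfv surj !dimvf dim_matrix => E1 E2.
  have {}E1 : \dim (lker Psi) = 7%N.
    by apply/eqP; rewrite -(eqn_add2r 3) E1.
  have := dimvS sub; rewrite E1 => le7.
  by rewrite -(leq_add2r (\dim (limg Phi))) E2; apply: (leq_add (leqnn 2) le7).
have [i0 i1] : (0 < \dim (lker Phi) /\ 1 < \dim (lker Phi))%N by split=> //; apply: ltnW.
pose b := vbasis (lker Phi).
have inb i (hi : (i < \dim (lker Phi))%N) : relation b`_i = 0.
  have : b`_i \in lker Phi by apply: vbasis_mem; rewrite mem_nth// size_tuple.
  by rewrite memv_ker lfunE /= => /eqP/(congr1 val).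
exists b`_0, b`_1; split; [|exact: inb|exact: inb].
move=> a c E.
have /freeP fb := basis_free (vbasisP (lker Phi)).
pose k (i : 'I_(\dim (lker Phi))) :=
  if (i == 0 :> nat) then a else if (i == 1 :> nat) then c else 0.
have k0 : forall i, k i = 0.
  apply: fb; rewrite (bigD1 (Ordinal i0))//= (bigD1 (Ordinal i1))//= big1 ?addr0.
    by rewrite /k /= -[RHS]E.
  by move=> i /andP[ni0 ni1]; rewrite /k ifF ?ifF ?scale0r//; apply/negbTE.
by have := k0 (Ordinal i0); have := k0 (Ordinal i1); rewrite /k /=.
Qed.

(** A singular member C of the pencil spanned by the matrices of two syzygies is a linear
    syzygy with dependent entries. *)
Lemma three_variable_net :
  (forall z, z \is 1.-form -> (forall m, m \is 1.-form -> annihilator (z * m)) -> z = 0) ->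
  dichotomy.
Proof.
move=> /two_linear_syzygies[A [B [ind EA EB]]].
have [a [b [v [ab v0 vE]]]] := singular_pencil A B.
set C := a *: A + b *: B in vE.
have C0 : C != 0.
  by apply: contraTneq ab => /ind[-> ->]; rewrite eqxx.
pose x i := linear_form (row i C).
have hx i : x i \is 1.-form by apply: linear_form_form.
have EC : l0 * x 0 + l1 * x 1 + l2 * x 2 = 0.
  rewrite /x /C !linearD !linearZ /= !linear_formD !linear_formZ.
  transitivity (a%:K * relation A + b%:K * relation B); first by rewrite /relation; ring.
  by rewrite EA EB !mulr0 addr0.
have E3 (f : 'I_3 -> 'rV[R]_3) : \sum_i f i = f 0 + f 1 + f 2.
  rewrite !big_ord_recl big_ord0 addr0 addrA.
  by congr (f _ + f _ + f _); apply: val_inj.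
have Ev : (v 0 0)%:K * x 0 + (v 0 1)%:K * x 1 + (v 0 2)%:K * x 2 = 0.
  rewrite /x -!linear_formZ -!linear_formD -(E3 (fun i => v 0 i *: row i C)).
  by rewrite -mulmx_sum_row vE /linear_form big1// => i _; rewrite mxE rmorph0 mul0r.
have xN0 : [|| x 0 != 0, x 1 != 0 | x 2 != 0].
  move: C0; apply: contraTT; rewrite !negb_or !negbK => /and3P[/eqP x0 /eqP x1 /eqP x2].
  apply/eqP/row_matrixP => i; rewrite row0; apply: linear_form_eq0.
  case: i => -[|[|[|//]]] hi; [have <- := x0|have <- := x1|have <- := x2];
    by congr (linear_form (row _ C)); apply: val_inj.
have B0 := net_basis_self N.
have [v00|v00] := eqVneq (v 0 0) 0; last first.
  exact: (degenerate_syzygy_net B0 (hx 0) (hx 1) (hx 2) EC Ev v00 xN0).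
have [v01|v01] := eqVneq (v 0 1) 0; last first.
  apply: (degenerate_syzygy_net (b := v 0 2) (c := v 0 0) (net_basis_perm B0)
    (hx 1) (hx 2) (hx 0) _ _ v01).
  - by rewrite addrC addrA.
  - by rewrite addrC addrA.
  - by rewrite orbA orbC.
have v02 : v 0 2 != 0.
  move: v0; apply: contraNneq => v02; apply/eqP/rowP => i; rewrite mxE.
  by case: i => -[|[|[|//]]] hi; [rewrite -[RHS]v00|rewrite -[RHS]v01|rewrite -[RHS]v02];
    congr (v _ _); apply: val_inj.
apply: (degenerate_syzygy_net (b := v 0 0) (c := v 0 1) (net_basis_perm (net_basis_perm B0))
  (hx 2) (hx 0) (hx 1) _ _ v02).
- by rewrite -addrA addrC.
- by rewrite -addrA addrC.
- by rewrite orbC -orbA.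
Qed.

Theorem second_order_net_dichotomy : dichotomy.
Proof.
have [[z [hz z0 Az]]|ess] := pselect (exists z, [/\ z \is 1.-form, z != 0 &
  forall m, m \is 1.-form -> annihilator (z * m)]).
  have [x [y F]] := frame_ext1 hz z0; have [_ hx hy _] := F.
  by apply: (two_variable_net N (frame_xzy (frame_yxz F))); apply: Az.
apply: three_variable_net => z hz Az; apply/eqP; apply: contra_notT ess => z0.
by exists z.
Qed.

End GenericNet.

(** * The exceptional net *)

Section SingularNet.
Variables (R : rcfType) (L : {scalar mpoly 3 R}) (l0 l1 l2 x y z : mpoly 3 R).
Hypothesis N : second_order_net L l0 l1 l2.
Hypothesis F : frame x y z.
Hypothesis B : net_basis l0 l1 l2 (x * x) (x * y) (y * y).
Hypotheses (m103 : moment L x y z 1 0 3 = 0) (m013 : moment L x y z 0 1 3 = 0).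
Hypothesis m004 : moment L x y z 0 0 4 < 0.

(** The coefficient of z^2 in q is read off from L(q z^2), because L vanishes on all other
    products of a monomial with z^2. *)
Lemma annihilator_vertex q v : q \is 2.-form -> annihilator L q ->
  meval v x = 0 -> meval v y = 0 -> meval v q = 0.
Proof.
move=> hq Aq vx vy; have [s0 s1 s2 _] := B.
have := net_annih N s0; have := net_annih N s1; have := net_annih N s2.
have -> : x * x = quadric_in x y z 1 0 0 0 0 0 by rewrite /quadric_in !rmorph0 rmorph1; ring.
have -> : x * y = quadric_in x y z 0 1 0 0 0 0 by rewrite /quadric_in !rmorph0 rmorph1; ring.
have -> : y * y = quadric_in x y z 0 0 0 1 0 0 by rewrite /quadric_in !rmorph0 rmorph1; ring.
move=> /(annih_quadric _ _ _ _ _ _ _ F)[_ [_ _ e1]].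
move=> /(annih_quadric _ _ _ _ _ _ _ F)[_ [_ _ e2]].
move=> /(annih_quadric _ _ _ _ _ _ _ F)[_ [_ _ e3]].
have [a [b [c [d [e [f qE]]]]]] := frame_quadric F hq.
move: Aq; rewrite qE => /(annih_quadric _ _ _ _ _ _ _ F)[_ [_ _ e4]].
have m022 : moment L x y z 0 2 2 = 0 by lra.
have m112 : moment L x y z 1 1 2 = 0 by lra.
have m202 : moment L x y z 2 0 2 = 0 by lra.
move: e4; rewrite m022 m112 m202 m103 m013 !mulr0 !add0r => /eqP.
rewrite mulf_eq0 (lt_eqF m004) orbF => /eqP f0.
by rewrite /quadric_in f0 !(mevalD, mevalM, mevalC) vx vy; ring.
Qed.

(** The linear syzygy y (x^2) = x (x y), rewritten in terms of l0, l1, l2, has entries m_j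
    in the span of x and y. The sum of their squares is a quadric in x and y, hence in the
    net, which determines the coefficients of the second-order correction. Finally L kills
    z^3 n because n is a combination of x and y. *)
Lemma escape_direction : exists m0 m1 m2 n (a0 a1 a2 : R),
  [/\ [/\ m0 \is 1.-form, m1 \is 1.-form & m2 \is 1.-form],
      l0 * m0 + l1 * m1 + l2 * m2 = 0,
      m0 * m0 + m1 * m1 + m2 * m2 + 2%:K * (a0%:K * l0 + a1%:K * l1 + a2%:K * l2) = 0,
      n = a0%:K * m0 + a1%:K * m1 + a2%:K * m2 /\ L (z * z * z * n) = 0 &
      0 < a0 ^+ 2 + a1 ^+ 2 + a2 ^+ 2].
Proof.
have [hx hy hz _] := F; have [_ _ lind _] := N.
have [[a0 [a1 [a2 E0]]] [b0 [b1 [b2 E1]]] [c0 [c1 [c2 E2]]] ind] := B.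
(* The coefficients of sum m_j^2 on x^2, x y, y^2; then e = - (p, q, r) A / 2, where the
   rows of A are the coordinates of x^2, x y and y^2 in l0, l1, l2. *)
pose p := b0 ^+ 2 + b1 ^+ 2 + b2 ^+ 2; pose q := - (2 * (a0 * b0 + a1 * b1 + a2 * b2)).
pose r := a0 ^+ 2 + a1 ^+ 2 + a2 ^+ 2.
pose e0 := - ((p * a0 + q * b0 + r * c0) / 2).
pose e1 := - ((p * a1 + q * b1 + r * c1) / 2).
pose e2 := - ((p * a2 + q * b2 + r * c2) / 2).
pose m0 := a0%:K * y - b0%:K * x; pose m1 := a1%:K * y - b1%:K * x.
pose m2 := a2%:K * y - b2%:K * x.
have msq : m0 * m0 + m1 * m1 + m2 * m2 = p%:K * (x * x) + q%:K * (x * y) + r%:K * (y * y).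
  by rewrite /m0 /m1 /m2 /p /q /r; ring.
have half (s t u : R) : 2 * (- ((s + t + u) / 2)) = - (s + t + u) by field.
exists m0, m1, m2, (e0%:K * m0 + e1%:K * m1 + e2%:K * m2), e0, e1, e2; split.
- by split; rewrite rpredB ?formZ.
- transitivity (y * (a0%:K * l0 + a1%:K * l1 + a2%:K * l2)
    - x * (b0%:K * l0 + b1%:K * l1 + b2%:K * l2)); first by rewrite /m0 /m1 /m2; ring.
  by rewrite -E0 -E1; ring.
- rewrite msq E0 E1 E2.
  transitivity ((2 * e0 + (p * a0 + q * b0 + r * c0))%:K * l0 +
     (2 * e1 + (p * a1 + q * b1 + r * c1))%:K * l1 +
     (2 * e2 + (p * a2 + q * b2 + r * c2))%:K * l2); first by ring.
  by rewrite /e0 /e1 /e2 !half !addNr rmorph0; ring.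
- split=> //.
  have -> : z * z * z * (e0%:K * m0 + e1%:K * m1 + e2%:K * m2) =
    (e0 * a0 + e1 * a1 + e2 * a2)%:K * (x ^+ 0 * y ^+ 1 * z ^+ 3) +
    (- (e0 * b0 + e1 * b1 + e2 * b2))%:K * (x ^+ 1 * y ^+ 0 * z ^+ 3).
    by rewrite /m0 /m1 /m2; ring.
  rewrite linearD !scalar_mpolyCM.
  by move: m103 m013; rewrite /moment => -> ->; ring.
(* If e = 0, then p = q = r = 0, so all a_j vanish and x^2 = sum a_j l_j = 0. *)
- rewrite lt_neqAle !addr_ge0 ?sqr_ge0// andbT eq_sym; apply/eqP => /eqP.
  rewrite !paddr_eq0 ?addr_ge0 ?sqr_ge0// !sqrf_eq0 => /andP[/andP[/eqP z0 /eqP z1] /eqP z2].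
  have {}z0 : p * a0 + q * b0 + r * c0 = 0.
    by move: (half (p * a0) (q * b0) (r * c0)); rewrite -/e0 z0; lra.
  have {}z1 : p * a1 + q * b1 + r * c1 = 0.
    by move: (half (p * a1) (q * b1) (r * c1)); rewrite -/e1 z1; lra.
  have {}z2 : p * a2 + q * b2 + r * c2 = 0.
    by move: (half (p * a2) (q * b2) (r * c2)); rewrite -/e2 z2; lra.
  have [] := ind p q r.
    rewrite E0 E1 E2; transitivity ((p * a0 + q * b0 + r * c0)%:K * l0 +
      (p * a1 + q * b1 + r * c1)%:K * l1 + (p * a2 + q * b2 + r * c2)%:K * l2); first by ring.
    by rewrite z0 z1 z2 rmorph0; ring.
  move=> _ _ /eqP; rewrite !paddr_eq0 ?addr_ge0 ?sqr_ge0// !sqrf_eq0.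
  move=> /andP[/andP[/eqP a00 /eqP a10] /eqP a20].
  have [] := ind 1 0 0; first by rewrite E0 a00 a10 a20 !rmorph0; ring.
  by move=> /eqP; rewrite oner_eq0.
Qed.

End SingularNet.

(** * The loss along lines *)

Section LossAlongLines.
Variables (R : realType) (ip : {dot R2 R for idfun}).
Implicit Types (f g h : R2 R) (a b c t : R).

Lemma ipC f g : ip f g = ip g f.
Proof. by rewrite hermC expr0 mul1r. Qed.

Lemma ipDl f g h : ip (f + g) h = ip f h + ip g h.
Proof. exact: linearDl. Qed.

Lemma ipZl c f g : ip (c *: f) g = c * ip f g.
Proof. exact: linearZl_LR. Qed.

Lemma ipDr f g h : ip h (f + g) = ip h f + ip h g.
Proof. by rewrite ipC ipDl !(ipC _ h). Qed.

Lemma ipZr c f g : ip f (c *: g) = c * ip f g.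
Proof. by rewrite ipC ipZl ipC. Qed.

Lemma ip0l f : ip 0 f = 0.
Proof. exact: linear0l. Qed.

Lemma ip_ge0 f : 0 <= ip f f.
Proof.
have [->|f0] := eqVneq f 0; last exact/ltW/neq0_dnorm_gt0.
by rewrite ip0l.
Qed.

Definition mulR1 (p q : R1 R) : R2 R :=
  DHomog (dhomogM (dhomog_is_dhomog p) (dhomog_is_dhomog q)).

Variable k : nat.
Implicit Types (l v w : R1tuple R k).

Definition entry l (i : 'I_k) : R1 R := (l : {ffun 'I_k -> R1 R}) i.

(** The polarization of sigma: half its derivative at l in the direction v. *)
Definition cross l v : R2 R := \sum_(i < k) mulR1 (entry l i) (entry v i).

Definition poly_of (f : R2 R) : mpoly 3 R := mpoly_of_dhomog (f : dhomog 3 R 4).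
Definition poly_of1 (f : R1 R) : mpoly 3 R := mpoly_of_dhomog (f : dhomog 3 R 2).

Lemma poly_of_inj : injective poly_of.
Proof. exact: val_inj. Qed.

Lemma poly_ofD f g : poly_of (f + g) = poly_of f + poly_of g.
Proof. by []. Qed.

Lemma poly_ofZ c f : poly_of (c *: f) = c%:K * poly_of f.
Proof. by rewrite mul_mpolyC. Qed.

Lemma poly_of_sum (F : 'I_k -> R2 R) : poly_of (\sum_i F i) = \sum_i poly_of (F i).
Proof. by apply: (big_morph poly_of) => //. Qed.

Lemma poly_cross l v : poly_of (cross l v) = \sum_i poly_of1 (entry l i) * poly_of1 (entry v i).
Proof. by rewrite poly_of_sum. Qed.

Lemma poly_sigma l : poly_of (sigma l) = \sum_i poly_of1 (entry l i) * poly_of1 (entry l i).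
Proof. by rewrite /sigma poly_of_sum. Qed.

Lemma entryD l v i : poly_of1 (entry (l + v) i) = poly_of1 (entry l i) + poly_of1 (entry v i).
Proof. by rewrite /entry ffunE. Qed.

Lemma entryZ c v i : poly_of1 (entry (c *: v) i) = c%:K * poly_of1 (entry v i).
Proof. by rewrite /entry ffunE mul_mpolyC. Qed.

Lemma cross_diag v : cross v v = sigma v.
Proof. by []. Qed.

Lemma crossDl l v w : cross (l + v) w = cross l w + cross v w.
Proof.
apply: poly_of_inj; rewrite poly_ofD !poly_cross -big_split.
by apply: eq_bigr => i _; rewrite entryD mulrDl.
Qed.

Lemma crossZl c l w : cross (c *: l) w = c *: cross l w.
Proof.
apply: poly_of_inj; rewrite poly_ofZ !poly_cross mulr_sumr.
by apply: eq_bigr => i _; rewrite entryZ -mulrA.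
Qed.

Lemma crossC l v : cross l v = cross v l.
Proof.
by apply: poly_of_inj; rewrite !poly_cross; apply: eq_bigr => i _; rewrite mulrC.
Qed.

Lemma crossDr l v w : cross w (l + v) = cross w l + cross w v.
Proof. by rewrite crossC crossDl !(crossC w). Qed.

Lemma crossZr c l w : cross w (c *: l) = c *: cross w l.
Proof. by rewrite crossC crossZl crossC. Qed.

Lemma sigma_line l v t : sigma (t *: v + l) = sigma l + (2 * t) *: cross l v + t ^+ 2 *: sigma v.
Proof.
rewrite -!cross_diag crossDl !crossDr !crossZl !crossZr (crossC v l).
by apply: poly_of_inj; rewrite !(poly_ofD, poly_ofZ); ring.
Qed.

Variable fbar : R2 R.

Lemma loss_line l v t : let g := sigma l - fbar in
  loss ip fbar (t *: v + l) = loss ip fbar l + t * (4 * ip g (cross l v))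
   + t ^+ 2 * (4 * ip (cross l v) (cross l v) + 2 * ip g (sigma v)
     + t * (4 * ip (cross l v) (sigma v)) + t ^+ 2 * ip (sigma v) (sigma v)).
Proof.
move=> g; rewrite /loss sigma_line -/g.
have -> : sigma l + (2 * t) *: cross l v + t ^+ 2 *: sigma v - fbar =
  g + (2 * t) *: cross l v + t ^+ 2 *: sigma v by rewrite /g addrAC [sigma l + _ - _]addrAC.
rewrite -/g; clearbody g.
rewrite !(ipDl, ipDr, ipZl, ipZr) (ipC (sigma v) (cross l v)) (ipC (sigma v) g) (ipC (cross l v) g).
ring.
Qed.

(** Derivatives are only taken of functions that are polynomial along lines, where the
    difference quotient is a polynomial with value a at 0. *)
Lemma derive_poly (V : normedModType R) (phi : V -> R) (x v : V) (a b c d : R) :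
  (forall t : R, phi (t *: v + x) = phi x + t * a + t ^+ 2 * (b + t * c + t ^+ 2 * d)) ->
  'D_v phi x = a.
Proof.
move=> E; apply: cvg_lim => //.
pose p : {poly R} := a%:P + 'X * (b%:P + 'X * c%:P + 'X ^+ 2 * d%:P).
have <- : p.[0] = a by rewrite /p !hornerE.
have /continuous_withinNx := @continuous_horner R p 0.
apply: cvg_trans; apply: near_eq_cvg; near=> t.
have t0 : t != 0 by near: t; apply: nbhs_dnbhs_neq.
rewrite /= E /p !hornerE /=.
rewrite -[LHS]mul1r -(mulVf t0) -mulrA; congr (_ * _); ring.
Unshelve. all: by end_near.
Qed.

End LossAlongLines.

(** * First- and second-order conditions *)

Section Critical.
Variables (R : realType) (ip : {dot R2 R for idfun}).
Variables (k : nat) (fbar : R2 R).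
Implicit Types (l v w : R1tuple R k) (t : R).

(** The first- and second-order conditions in terms of the residual g. Both stationary
    points and local minima are brought to this form, the latter without computing
    derivatives. *)
Definition critical l := let g := sigma l - fbar in
  (forall v, ip g (cross l v) = 0) /\
  (forall v, 0 <= 2 * ip (cross l v) (cross l v) + ip g (sigma v)).

Lemma derive_loss l v : 'D_v (loss ip fbar) l = 4 * ip (sigma l - fbar) (cross l v).
Proof. by apply: derive_poly => t; apply: loss_line. Qed.

Lemma hessian_loss l v : hessian (loss ip fbar) l v v =
  4 * (2 * ip (cross l v) (cross l v) + ip (sigma l - fbar) (sigma v)).
Proof.
rewrite /hessian (_ : 'D_v (loss ip fbar) = fun y => 4 * ip (sigma y - fbar) (cross y v)).
  2: by apply/funext => y; rewrite derive_loss.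
apply: (@derive_poly _ _ _ _ _ _ (12 * ip (cross l v) (sigma v))
  (4 * ip (sigma v) (sigma v)) 0) => t.
rewrite sigma_line crossDl crossZl cross_diag.
set g := sigma l - fbar.
have -> : sigma l + (2 * t) *: cross l v + t ^+ 2 *: sigma v - fbar =
  g + (2 * t) *: cross l v + t ^+ 2 *: sigma v by rewrite /g addrAC [sigma l + _ - _]addrAC.
clearbody g.
rewrite !(ipDl, ipDr, ipZl, ipZr) (ipC ip (sigma v) (cross l v)).
ring.
Qed.

Lemma stationary_critical l : zero_gradient (loss ip fbar) l ->
  psd_hessian (loss ip fbar) l -> critical l.
Proof.
move=> G H; split=> v.
  have /eqP := G v; rewrite derive_loss mulf_eq0 pnatr_eq0 => /eqP; exact.
by have := H v; rewrite hessian_loss pmulr_rge0.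
Qed.

Lemma near0_horner_gt0 (p : {poly R}) : 0 < p.[0] -> \forall t \near (0 : R), 0 < p.[t].
Proof. by move=> p0; have /cvgr_gt/(_ _ p0) := @continuous_horner R p 0. Qed.

(** Approaching a point along a parabola; lines are the case w = 0. *)
Lemma near_parabola (V : normedModType R) (x v w : V) (P : V -> Prop) :
  (\forall y \near x, P y) -> \forall t \near (0 : R), P (t *: v + t ^+ 2 *: w + x).
Proof.
move=> xP.
have : t *: v + t ^+ 2 *: w + x @[t --> (0 : R)] --> (0 : R) *: v + (0 : R) ^+ 2 *: w + x.
  apply: cvgD; last exact: cvg_cst.
  apply: cvgD; apply: cvgZ; try exact: cvg_cst; first exact: cvg_id.
  exact: exprn_continuous.
by rewrite expr2 mul0r !scale0r !add0r; apply.
Qed.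

(** Along each line the loss is a polynomial in t; after removal of the factor t,
    respectively t^2, a negative leading term would persist for small t > 0. *)
Lemma local_min_critical l : local_min (loss ip fbar) l -> critical l.
Proof.
move=> lm.
have H v : \forall t \near (0 : R), loss ip fbar l <= loss ip fbar (t *: v + l).
  have := near_parabola v 0 (lm : \forall y \near l, _); apply: filterS => t.
  by rewrite scaler0 addr0.
pose b v := 4 * ip (cross l v) (cross l v) + 2 * ip (sigma l - fbar) (sigma v).
pose q v : {poly R} := (b v)%:P + 'X * (4 * ip (cross l v) (sigma v))%:P
  + 'X ^+ 2 * (ip (sigma v) (sigma v))%:P.
have qE v t : loss ip fbar (t *: v + l) = loss ip fbar l +
    t * (4 * ip (sigma l - fbar) (cross l v)) + t ^+ 2 * (q v).[t].
  by rewrite loss_line /q !hornerE.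
have G v : 0 <= ip (sigma l - fbar) (cross l v).
  rewrite leNgt; apply/negP => neg.
  pose p : {poly R} := (- (4 * ip (sigma l - fbar) (cross l v)))%:P - 'X * q v.
  have p0 : 0 < p.[0] by rewrite /p !hornerE /=; lra.
  have [t [t0 t1 t2]] : exists t : R, [/\ 0 < t, 0 < p.[t] &
      loss ip fbar l <= loss ip fbar (t *: v + l)].
    near (0 : R)^'+ => t; exists t; split; near: t => //.
    - exact: nbhs_right_gt.
    - by apply: cvg_within; apply: near0_horner_gt0.
    - by apply: cvg_within; apply: H.
  have := mulr_gt0 t0 t1; move: t2; rewrite qE /p /q !hornerE -addrA lerDl /= => t2 t3.
  by lra.
have G0 v : ip (sigma l - fbar) (cross l v) = 0.
  apply/eqP; rewrite eq_le G andbT -oppr_ge0.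
  by have := G (-1 *: v); rewrite crossZr ipZr mulN1r.
split=> // v; rewrite leNgt; apply/negP => neg.
have q0 : 0 < (- q v).[0] by rewrite /q !hornerE /= /b; lra.
have [t [t0 t1]] : exists t : R, [/\ 0 < t, 0 < (- q v).[t] &
    loss ip fbar l <= loss ip fbar (t *: v + l)].
  near (0 : R)^'+ => t; exists t; split; near: t => //.
  - exact: nbhs_right_gt.
  - by apply: cvg_within; apply: near0_horner_gt0.
  - by apply: cvg_within; apply: H.
rewrite qE G0 !mulr0 addr0 lerDl pmulr_rge0 ?exprn_gt0//.
by rewrite hornerN oppr_gt0 in t1; rewrite leNgt t1.
Unshelve. all: by end_near.
Qed.

End Critical.

(** * The functional defined by the residual *)

Section Residual.
Variables (R : realType) (ip : {dot R2 R for idfun}) (g : R2 R).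

(** Projecting to degree four first makes the functional total on polynomials. *)
Definition residual (p : mpoly 3 R) : R :=
  ip (DHomog (pihomogP mdeg 4 p) : R2 R) g.

Lemma residual_scalar : scalar residual.
Proof.
move=> a p q; rewrite /residual -ipZl -ipDl; congr (ip _ g).
by apply: val_inj; rewrite /= linearP.
Qed.

HB.instance Definition _ :=
  GRing.isLinear.Build R (mpoly 3 R) R _ residual residual_scalar.

Lemma residualE (f : R2 R) : residual (poly_of f) = ip g f.
Proof.
rewrite ipC /residual; congr (ip _ g); apply: val_inj => /=.
by rewrite pihomog_dE//; apply: dhomog_is_dhomog.
Qed.

End Residual.

(** * From critical points to nets *)

Section CriticalNet.
Variables (R : realType) (ip : {dot R2 R for idfun}) (fbar : R2 R).

Lemma poly_of1_form (q : R1 R) : poly_of1 q \is 2.-form.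
Proof. exact: dhomog_is_dhomog. Qed.

Lemma poly_of1_surj (p : mpoly 3 R) : p \is 2.-form -> exists q : R1 R, poly_of1 q = p.
Proof. by move=> hp; exists (DHomog hp). Qed.

Lemma ip_sqrD (f h : R2 R) : ip (f + h) (f + h) = ip f f + (2 * ip f h + ip h h).
Proof. by rewrite ipDl !ipDr (ipC ip h f); ring. Qed.

(** The loss is a convex function of sigma, and its linear part at sigma(l) is
    L(sigma(y)) - L(sigma(l)), with L(sigma(l)) = 0 by stationarity. *)
Lemma psd_global_min k (l : R1tuple R k) : critical ip fbar l ->
  psd_on_squares (residual ip (sigma l - fbar)) -> global_min (loss ip fbar) l.
Proof.
move=> [G _] psd y; rewrite /loss; set g := sigma l - fbar.
have -> : sigma y - fbar = g + (sigma y - sigma l) by rewrite /g [RHS]addrC addrA subrK.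
rewrite ip_sqrD lerDl.
have gl : ip g (sigma l) = 0 by rewrite -cross_diag G.
have gy : 0 <= ip g (sigma y).
  rewrite -residualE poly_sigma linear_sum sumr_ge0// => i _.
  exact/psd/poly_of1_form.
have E : ip g (sigma y - sigma l) = ip g (sigma y).
  by rewrite ipDr -scaleN1r ipZr gl mulr0 addr0.
by rewrite E addr_ge0 ?ip_ge0 ?mulr_ge0.
Qed.

Variable k : nat.
Implicit Types (l v w : R1tuple R k.+3).
Let i0 : 'I_k.+3 := ord0.
Let i1 : 'I_k.+3 := lift ord0 ord0.
Let i2 : 'I_k.+3 := lift ord0 (lift ord0 ord0).

(** Test directions supported on the three entries that span the net. *)
Definition head_tuple (y0 y1 y2 : R1 R) : R1tuple R k.+3 :=
  [ffun i : 'I_k.+3 => nth 0 [:: y0; y1; y2] i].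

Lemma sum_head_tuple (A : nmodType) (F : R1 R -> R1 R -> A) l y0 y1 y2 :
  (forall q, F q 0 = 0) ->
  \sum_i F (entry l i) (entry (head_tuple y0 y1 y2) i) =
  F (entry l i0) y0 + F (entry l i1) y1 + F (entry l i2) y2.
Proof.
move=> F0; rewrite 3!big_ord_recl big1 => [|i _].
  by rewrite /entry !ffunE /= addr0 !addrA.
by rewrite /entry ffunE /= nth_nil F0.
Qed.

Lemma poly_cross_head_tuple l y0 y1 y2 : poly_of (cross l (head_tuple y0 y1 y2)) =
  poly_of1 (entry l i0) * poly_of1 y0 + poly_of1 (entry l i1) * poly_of1 y1
  + poly_of1 (entry l i2) * poly_of1 y2.
Proof.
rewrite poly_cross (@sum_head_tuple _ (fun p q => poly_of1 p * poly_of1 q))// => q.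
exact: mulr0.
Qed.

Lemma poly_sigma_head_tuple y0 y1 y2 : poly_of (sigma (head_tuple y0 y1 y2)) =
  poly_of1 y0 * poly_of1 y0 + poly_of1 y1 * poly_of1 y1 + poly_of1 y2 * poly_of1 y2.
Proof.
rewrite poly_sigma.
rewrite (@sum_head_tuple _ (fun p q => poly_of1 q * poly_of1 q) (head_tuple y0 y1 y2))// => q.
exact: mulr0.
Qed.

Lemma critical_annih l i : critical ip fbar l ->
  annihilator (residual ip (sigma l - fbar)) (poly_of1 (entry l i)).
Proof.
move=> [G _] p /poly_of1_surj[q <-].
pose v : R1tuple R k.+3 := [ffun j => if j == i then q else 0].
have <- : poly_of (cross l v) = poly_of1 (entry l i) * poly_of1 q.
  rewrite poly_cross (bigD1 i)//= big1 ?addr0 => [|j ji]; rewrite /entry ffunE.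
    by rewrite eqxx.
  by rewrite (negPf ji) mulr0.
by rewrite /= residualE G.
Qed.

Lemma linear_coef_eq0 (a b : R) : (forall t, 0 <= t * b + t ^+ 2 * a) -> b = 0.
Proof.
move=> H; have a0 : 0 <= a by have := H 1; have := H (-1); lra.
pose t := - b / (a + 1).
have a1 : a + 1 != 0 by rewrite gt_eqF// ltr_wpDl.
have := H t; have -> : t * b + t ^+ 2 * a = - (t ^+ 2).
  by rewrite /t; field.
rewrite oppr_ge0 => t2; have : t ^+ 2 == 0 by rewrite eq_le t2 sqr_ge0.
by rewrite sqrf_eq0 /t mulf_eq0 invr_eq0 (negPf a1) orbF oppr_eq0 => /eqP.
Qed.

(** A linear relation with coefficients a, b, c between the first three entries makes
    (a q, b q, c q) a syzygy for every quadric q. Otherwise the entries span a net, and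
    the equality clause comes from the first variation of the second-order condition
    around an isotropic syzygy. *)
Lemma critical_dichotomy l : critical ip fbar l ->
  psd_on_squares (residual ip (sigma l - fbar)) \/
  second_order_net (residual ip (sigma l - fbar)) (poly_of1 (entry l i0))
    (poly_of1 (entry l i1)) (poly_of1 (entry l i2)).
Proof.
move=> C; have [G H] := C.
pose L : {scalar mpoly 3 R} := residual ip (sigma l - fbar); rewrite -/L.
have LE f : L (poly_of f) = ip (sigma l - fbar) f by exact: residualE.
have [ind|/existsNP[a /existsNP[b /existsNP[c /not_implyP[E nz]]]]] :=
  pselect (indep3 (poly_of1 (entry l i0)) (poly_of1 (entry l i1)) (poly_of1 (entry l i2))).
- right; split=> //; [by split; apply: poly_of1_form|by split; apply: critical_annih|].
  move=> _ _ _ /poly_of1_surj[y0 <-] /poly_of1_surj[y1 <-] /poly_of1_surj[y2 <-] E.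
  have c0 : cross l (head_tuple y0 y1 y2) = 0.
    by apply: poly_of_inj; rewrite poly_cross_head_tuple E.
  rewrite -poly_sigma_head_tuple LE.
  have := H (head_tuple y0 y1 y2); rewrite c0 ip0l mulr0 add0r => Hy; split=> // Hy0.
  (* The second-order condition at y + t w, whose constant term vanishes. *)
  have key w : ip (sigma l - fbar) (cross (head_tuple y0 y1 y2) w) = 0.
    suff : 2 * ip (sigma l - fbar) (cross (head_tuple y0 y1 y2) w) = 0.
      by move=> /eqP; rewrite mulf_eq0 pnatr_eq0 => /eqP.
    apply: (@linear_coef_eq0 (2 * ip (cross l w) (cross l w) + ip (sigma l - fbar) (sigma w))) => t.
    have := H (t *: w + head_tuple y0 y1 y2).
    rewrite sigma_line crossDr c0 addr0 !crossZr !(ipDr, ipZr, ipZl) Hy0.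
    congr (0 <= _); ring.
  have L0 q w p : poly_of (cross (head_tuple y0 y1 y2) w) = p * poly_of1 q ->
      L (p * poly_of1 q) = 0.
    by move=> <-; rewrite LE key.
  split=> _ /poly_of1_surj[q <-].
  + apply: (L0 _ (head_tuple q 0 0)).
    by rewrite poly_cross_head_tuple /entry !ffunE /= !mulr0 !addr0.
  + apply: (L0 _ (head_tuple 0 q 0)).
    by rewrite poly_cross_head_tuple /entry !ffunE /= !mulr0 addr0 add0r.
  + apply: (L0 _ (head_tuple 0 0 q)).
    by rewrite poly_cross_head_tuple /entry !ffunE /= !mulr0 !add0r.
- left=> _ /poly_of1_surj[q <-].
  have := H (head_tuple (a *: q) (b *: q) (c *: q)).
  have -> : cross l (head_tuple (a *: q) (b *: q) (c *: q)) = 0.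
    apply: poly_of_inj; rewrite poly_cross_head_tuple.
    have EZ s : poly_of1 (s *: q) = s%:K * poly_of1 q by rewrite mul_mpolyC.
    rewrite !EZ -[RHS](mul0r (poly_of1 q)) -E; ring.
  rewrite ip0l mulr0 add0r -LE poly_sigma_head_tuple.
  have -> : poly_of1 (a *: q) * poly_of1 (a *: q) + poly_of1 (b *: q) * poly_of1 (b *: q) +
     poly_of1 (c *: q) * poly_of1 (c *: q) =
     (a ^+ 2 + b ^+ 2 + c ^+ 2)%:K * (poly_of1 q * poly_of1 q).
    have EZ s : poly_of1 (s *: q) = s%:K * poly_of1 q by rewrite mul_mpolyC.
    by rewrite !EZ; ring.
  rewrite scalar_mpolyCM pmulr_rge0//.
  rewrite lt_neqAle !addr_ge0 ?sqr_ge0// andbT eq_sym; apply/eqP => s0; apply: nz.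
  move: s0 => /eqP; rewrite !paddr_eq0 ?addr_ge0 ?sqr_ge0// !sqrf_eq0.
  by move=> /andP[/andP[/eqP-> /eqP->] /eqP->].
Qed.

Lemma critical_singular_net l : critical ip fbar l -> ~ global_min (loss ip fbar) l ->
  let L : {scalar mpoly 3 R} := residual ip (sigma l - fbar) in
  let l0 := poly_of1 (entry l i0) in let l1 := poly_of1 (entry l i1) in
  let l2 := poly_of1 (entry l i2) in
  second_order_net L l0 l1 l2 /\ singular_net L l0 l1 l2.
Proof.
move=> C ng; have [psd|N] := critical_dichotomy C; first by case: ng; apply: psd_global_min.
have [psd|S] := second_order_net_dichotomy N; last by split.
by case: ng; apply: psd_global_min.
Qed.

End CriticalNet.

(** * Interior points, local minima and binary forms *)

Section Conclusions.
Variables (R : realType) (ip : {dot R2 R for idfun}) (fbar : R2 R).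

Lemma poly_of_surj (p : mpoly 3 R) : p \is 4.-form -> exists h : R2 R, poly_of h = p.
Proof. by move=> hp; exists (DHomog hp). Qed.

Lemma SOScone_sigma k (l : R1tuple R k) : SOScone R (sigma l).
Proof. by exists k, l. Qed.

Lemma SOScone_ge0 (f : R2 R) v : SOScone R f -> 0 <= meval v (poly_of f).
Proof.
move=> [k [l ->]]; rewrite poly_sigma rmorph_sum sumr_ge0// => i _.
by rewrite /= mevalM -expr2 sqr_ge0.
Qed.

(** An interior form remains a sum of squares, hence nonnegative, after subtraction of a
    small multiple of z^4. *)
Lemma interior_pos (f : R2 R) x y z : frame x y z -> (SOScone R)° f ->
  exists v, [/\ meval v x = 0, meval v y = 0 & 0 < meval v (poly_of f)].
Proof.
move=> F If; have [v [vx vy vz]] := frame_point 0 0 1 F; exists v; split=> //.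
have [_ _ hz _] := F.
have [h hE] := @poly_of_surj (z * z * (z * z)) (dhomogM (formM1 hz hz) (formM1 hz hz)).
have [t [t0 ft]] : exists t : R, 0 < t /\ SOScone R (t *: (- h) + t ^+ 2 *: 0 + f).
  near (0 : R)^'+ => t; exists t; split; near: t => //.
  - exact: nbhs_right_gt.
  - by apply: cvg_within; apply: near_parabola.
have := SOScone_ge0 v ft; rewrite scaler0 addr0 scalerN addrC.
have -> : poly_of (f - t *: h) = poly_of f - t%:K * (z * z * (z * z)).
  by rewrite -hE -poly_ofZ.
by rewrite mevalB !mevalM mevalC vz !mulr1 subr_ge0; apply: lt_le_trans.
Unshelve. all: by end_near.
Qed.

Section Singular.
Variables (k : nat) (l : R1tuple R k.+3) (x y z : mpoly 3 R).
Let g := sigma l - fbar.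
Let L : {scalar mpoly 3 R} := residual ip g.
Let l0 := poly_of1 (entry l ord0).
Let l1 := poly_of1 (entry l (lift ord0 ord0)).
Let l2 := poly_of1 (entry l (lift ord0 (lift ord0 ord0))).
Hypothesis C : critical ip fbar l.
Hypothesis N : second_order_net L l0 l1 l2.
Hypothesis F : frame x y z.
Hypothesis B : net_basis l0 l1 l2 (x * x) (x * y) (y * y).
Hypotheses (m103 : moment L x y z 1 0 3 = 0) (m013 : moment L x y z 0 1 3 = 0).
Hypothesis m004 : moment L x y z 0 0 4 < 0.

Lemma singular_not_interior : ~ (SOScone R)° (sigma l).
Proof.
move=> /(interior_pos F)[v [vx vy]]; rewrite poly_sigma rmorph_sum big1 ?ltxx// => i _.
have /= li := critical_annih i C.
by rewrite /= mevalM (annihilator_vertex N F B m103 m013 m004 (poly_of1_form _) li vx vy) mul0r.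
Qed.

End Singular.

Section SingularRankThree.
Variables (l : R1tuple R 3) (x y z : mpoly 3 R).
Let g := sigma l - fbar.
Let L : {scalar mpoly 3 R} := residual ip g.
Let l0 := poly_of1 (entry l ord0).
Let l1 := poly_of1 (entry l (lift ord0 ord0)).
Let l2 := poly_of1 (entry l (lift ord0 (lift ord0 ord0))).
Hypothesis N : second_order_net L l0 l1 l2.
Hypothesis F : frame x y z.
Hypothesis B : net_basis l0 l1 l2 (x * x) (x * y) (y * y).
Hypotheses (m103 : moment L x y z 1 0 3 = 0) (m013 : moment L x y z 0 1 3 = 0).
Hypothesis m004 : moment L x y z 0 0 4 < 0.

Lemma poly_sigma3 (v : R1tuple R 3) : poly_of (sigma v) =
  poly_of1 (entry v ord0) * poly_of1 (entry v ord0)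
  + poly_of1 (entry v (lift ord0 ord0)) * poly_of1 (entry v (lift ord0 ord0))
  + poly_of1 (entry v (lift ord0 (lift ord0 ord0))) *
    poly_of1 (entry v (lift ord0 (lift ord0 ord0))).
Proof. by rewrite poly_sigma !big_ord_recl big_ord0 addr0 addrA. Qed.

(** For the data of [escape_direction], the curve l + t (z m) + t^2 (alpha z^2) has sigma
    constant up to order t^2; the term of order t^3 is a multiple of z^3 n, killed by L,
    and that of order t^4 is |alpha|^2 z^4. *)
Lemma escape_curve : exists (v w : R1tuple R 3) (h1 h2 : R2 R) (s : R),
  [/\ 0 < s, ip g h1 = 0, ip g h2 < 0 & forall t,
    sigma (t *: v + t ^+ 2 *: w + l) = sigma l + (2 * t ^+ 3) *: h1 + (s * t ^+ 4) *: h2].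
Proof.
have [m0 [m1 [m2 [n [a0 [a1 [a2 [[hm0 hm1 hm2] E1 E2 [nE Ln] s0]]]]]]]] :=
  escape_direction N F B m103 m013.
have [_ _ hz _] := F.
have hn : n \is 1.-form by rewrite nE !rpredD ?formZ.
have [v0 v0E] := poly_of1_surj (formM1 hz hm0).
have [v1 v1E] := poly_of1_surj (formM1 hz hm1).
have [v2 v2E] := poly_of1_surj (formM1 hz hm2).
have [w wE] := poly_of1_surj (formM1 hz hz).
have h1f : z * z * z * n \is 4.-form.
  by rewrite -mulrA; apply: dhomogM (formM1 hz hz) (formM1 hz hn).
have [h1 h1E] := poly_of_surj h1f.
have h2f : z * z * (z * z) \is 4.-form by exact: dhomogM (formM1 hz hz) (formM1 hz hz).
have [h2 h2E] := poly_of_surj h2f.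
exists (head_tuple 0 v0 v1 v2), (head_tuple 0 (a0 *: w) (a1 *: w) (a2 *: w)), h1, h2,
  (a0 ^+ 2 + a1 ^+ 2 + a2 ^+ 2).
split=> //.
- by rewrite -residualE h1E.
- rewrite -residualE h2E; move: m004; rewrite /moment; congr (L _ < 0); ring.
move=> t; apply: poly_of_inj; rewrite poly_sigma3 !poly_ofD !poly_ofZ !entryD !entryZ.
rewrite h1E h2E poly_sigma3 -/l0 -/l1 -/l2.
have EZ (a : R) : a *: mpoly_of_dhomog w = a%:K * (z * z) by rewrite -wE mul_mpolyC.
rewrite /head_tuple /entry !ffunE /= v0E v1E v2E !EZ nE.
transitivity (l0 * l0 + l1 * l1 + l2 * l2
  + (2 * t)%:K * z * (l0 * m0 + l1 * m1 + l2 * m2)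
  + (t ^+ 2)%:K * z * z * (m0 * m0 + m1 * m1 + m2 * m2
     + 2%:K * (a0%:K * l0 + a1%:K * l1 + a2%:K * l2))
  + (2 * t ^+ 3)%:K * (z * z * z * (a0%:K * m0 + a1%:K * m1 + a2%:K * m2))
  + ((a0 ^+ 2 + a1 ^+ 2 + a2 ^+ 2) * t ^+ 4)%:K * (z * z * (z * z))); first by ring.
by rewrite E1 E2; ring.
Qed.

(** Along the curve the cubic term of sigma is orthogonal to the residual and contributes
    to the loss only at order t^6, while the quartic term contributes 2 |alpha|^2 L(z^4)
    t^4 < 0. *)
Lemma singular_not_local_min : ~ local_min (loss ip fbar) l.
Proof.
move=> lm; have [v [w [h1 [h2 [s [s0 gh1 gh2 curve]]]]]] := escape_curve.
(* The loss decreases by t^4 q(t). *)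
pose q : {poly R} := (- (2 * s * ip g h2))%:P
  - 'X ^+ 2 * ((4 * ip h1 h1)%:P + 'X * (4 * s * ip h1 h2)%:P + 'X ^+ 2 * (s ^+ 2 * ip h2 h2)%:P).
have q0 : 0 < q.[0].
  by rewrite /q !hornerE /= expr0n /= mul0r subr0 oppr_gt0 pmulr_rlt0// mulr_gt0.
have [t [t0 qt lt]] : exists t : R, [/\ 0 < t, 0 < q.[t] &
    loss ip fbar l <= loss ip fbar (t *: v + t ^+ 2 *: w + l)].
  near (0 : R)^'+ => t; exists t; split; near: t => //.
  - exact: nbhs_right_gt.
  - by apply: cvg_within; apply: near0_horner_gt0.
  - by apply: cvg_within; apply: (near_parabola v w lm).
suff E : loss ip fbar (t *: v + t ^+ 2 *: w + l) = loss ip fbar l - t ^+ 4 * q.[t].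
  move: lt; rewrite E lerBrDr gerDl; apply/negP; rewrite -ltNge.
  by rewrite mulr_gt0 ?exprn_gt0.
rewrite /loss curve.
have -> : sigma l + (2 * t ^+ 3) *: h1 + (s * t ^+ 4) *: h2 - fbar =
  g + (2 * t ^+ 3) *: h1 + (s * t ^+ 4) *: h2 by rewrite /g addrAC [sigma l + _ - _]addrAC.
rewrite -/g /q !hornerE /=; move: gh1; clearbody g => gh1.
rewrite !(ipDl, ipDr, ipZl, ipZr) (ipC ip h1 g) (ipC ip h2 g) (ipC ip h2 h1) gh1; ring.
Unshelve. all: by end_near.
Qed.

Lemma linear_changeM (M : 'M[R]_3) p q :
  linear_change M (p * q) = linear_change M p * linear_change M q.
Proof. exact: rmorphM. Qed.

Lemma linear_changeD (M : 'M[R]_3) p q :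
  linear_change M (p + q) = linear_change M p + linear_change M q.
Proof. exact: rmorphD. Qed.

Lemma linear_changeC (M : 'M[R]_3) (c : R) : linear_change M c%:K = c%:K.
Proof. exact: comp_mpolyC. Qed.

(** The entries of l are combinations of x^2, x y and y^2; the inverse of the matrix of
    the frame x, y, z turns x and y into the first two variables. *)
Lemma singular_projectively_binary : projectively_binary (sigma l).
Proof.
have [A [M [AM eE XE]]] := frame_matrix F.
have [_ M_unit] := mulmx1_unit AM.
have change_frame i : linear_change M (tnth [tuple x; y; z] i) = X i.
  rewrite eE.
  transitivity (\sum_k ((A *m M) i k)%:K * X k : mpoly 3 R).
    rewrite /linear_change rmorph_sum /=.
    under eq_bigr => j _.
      rewrite rmorphM /= comp_mpolyC comp_mpolyXU -tnth_nth tnth_mktuple mulr_sumr.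
      over.
    rewrite exchange_big; apply: eq_bigr => k _.
    rewrite mxE rmorph_sum mulr_suml; apply: eq_bigr => j _.
    by rewrite rmorphM /var -mul_mpolyC mulrA.
  rewrite AM (bigD1 i)//= mxE eqxx rmorph1 mul1r big1 ?addr0// => j ji.
  by rewrite mxE eq_sym (negPf ji) rmorph0 mul0r.
have xE : linear_change M x = X 0 by exact: (change_frame 0).
have yE : linear_change M y = X 1 by exact: (change_frame 1).
have [[a0 [b0 [c0 E0]]] [a1 [b1 [c1 E1]]] [a2 [b2 [c2 E2]]]] := net_basis_sym B.
pose Y (i : 'I_2) : mpoly 2 R := mpolyX _ (mnm1 i).
have YY i j : Y i * Y j \is @ishomog1 2 R 2 mdeg.
  by apply: (@dhomogM _ _ _ 1 _ 1); rewrite dhomogX /= mdeg1.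
pose b a b c : mpoly 2 R := mpolyC 2 a * (Y 0 * Y 0) + mpolyC 2 b * (Y 0 * Y 1)
  + mpolyC 2 c * (Y 1 * Y 1).
have hb s t r : b s t r \is @ishomog1 2 R 2 mdeg.
  by rewrite /b !mul_mpolyC !rpredD ?rpredZ.
have h4 : b a0 b0 c0 * b a0 b0 c0 + b a1 b1 c1 * b a1 b1 c1 + b a2 b2 c2 * b a2 b2 c2
    \is @ishomog1 2 R 4 mdeg.
  by rewrite !rpredD//; apply: (@dhomogM _ _ _ 2 _ 2).
exists M, (DHomog h4); split=> //.
have wY0 : mwiden (Y 0) = X 0.
  by rewrite /Y mwidenX mnmwiden1; congr (mpolyX _ (mnm1 _)); apply: val_inj.
have wY1 : mwiden (Y 1) = X 1.
  by rewrite /Y mwidenX mnmwiden1; congr (mpolyX _ (mnm1 _)); apply: val_inj.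
rewrite -/(poly_of _) poly_sigma3 -/l0 -/l1 -/l2 E0 E1 E2 /=.
rewrite !(linear_changeD, linear_changeM, linear_changeC) xE yE.
by rewrite /b !(mwidenD, mwidenM, mwidenC) wY0 wY1.
Qed.

End SingularRankThree.

End Conclusions.

Theorem theorem1p3 (R : realType) (ip : {dot R2 R for idfun}) :
  (forall (k : nat) (fbar : R2 R) (l : R1tuple R k), (3 <= k)%N ->
     (SOScone R)° (sigma l) ->
     ~ spurious_second_order_stationary (loss ip fbar) l) /\
  ((forall (fbar : R2 R) (l : R1tuple R 3),
      ~ spurious_local_min (loss ip fbar) l) /\
   (forall (fbar : R2 R) (l : R1tuple R 3),
      spurious_second_order_stationary (loss ip fbar) l ->
      infinite_set [set F | gram (sigma l) F /\ (\rank F <= 3)%N] ->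
      boundary (SOScone R) (sigma l) /\ projectively_binary (sigma l))).
Proof.
have part1 k fbar (l : R1tuple R k) : (3 <= k)%N -> (SOScone R)° (sigma l) ->
    ~ spurious_second_order_stationary (loss ip fbar) l.
  case: k l => [|[|[|k]]]// l _ int [G H ng]; have C := stationary_critical G H.
  have [N [x [y [z [F B [m1 m2 m3]]]]]] := critical_singular_net C ng.
  exact: (singular_not_interior C N F B m1 m2 m3 int).
split; [exact: part1|split=> [fbar l [lm ng]|fbar l S _]].
- have [N [x [y [z [F B [m1 m2 m3]]]]]] := critical_singular_net (local_min_critical lm) ng.
  exact: (singular_not_local_min N F B m1 m2 m3 lm).
- split.
    split; first by apply: subset_closure; apply: SOScone_sigma.
    by move=> int; apply: (part1 _ _ _ _ int S).
  have [G H ng] := S.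
  have [N [x [y [z [F B _]]]]] := critical_singular_net (stationary_critical G H) ng.
  exact: (singular_projectively_binary F B).
Qed.
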